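(* For every $\eta>0$ and $d\in\mathbb{N}$ there exist $c\in\mathbb{N}$ and $\kappa>0$ such that the following holds: Let $S$ be a search problem that takes inputs from $\{0,1\}^\ell$, and let $\mathrm{gd}:\{0,1\}^t\times\{0,1\}^t\to\{0,1\}$ be an arbitrary function such that $\mathrm{disc}(\mathrm{gd})\le2^{-\eta\cdot t}$ and such that $t\ge c\cdot\log\ell$. Let $\mathcal{X},\mathcal{Y}\subseteq(\{0,1\}^t)^\ell$ be such that for every $I\subseteq[\ell]$ both $\mathrm{rAvgDeg}_I(\mathcal{X})$ and $\mathrm{rAvgDeg}_I(\mathcal{Y})$ are at least $1/(d\cdot\ell^d)^{|I|}$. Then the communication complexity of solving $S\diamond\mathrm{gd}$ on inputs from $\mathcal{X}\times\mathcal{Y}$ is at least $\kappa\cdot\mathsf{Q}(S)\cdot t$.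
   Context: All logarithms are base 2. A search problem $S\subseteq\{0,1\}^\ell\times\mathcal{O}$ is the task: given $z$, find $o\in S(z)=\{o:(z,o)\in S\}$; $S(z)$ is assumed non-empty for all $z$. $\mathsf{Q}(S)$ is the minimal depth of a deterministic decision tree (querying individual input bits) that outputs an element of $S(z)$ on every $z$. With $\Lambda=\{0,1\}^t$, $S\diamond\mathrm{gd}\subseteq\Lambda^\ell\times\Lambda^\ell\times\mathcal{O}$ is the communication problem in which Alice gets $x\in\Lambda^\ell$, Bob gets $y\in\Lambda^\ell$, and they must output an element of $S(\mathrm{gd}(x_1,y_1),\dots,\mathrm{gd}(x_\ell,y_\ell))$. The communication complexity of solving it on $\mathcal{X}\times\mathcal{Y}$ is the minimal depth of a deterministic protocol tree that is correct for all $(x,y)\in\mathcal{X}\times\mathcal{Y}$. Discrepancy: for $\boldsymbol u,\boldsymbol v$ independent uniform over $\Lambda$ and a combinatorial rectangle $R\subseteq\Lambda\times\Lambda$, $\mathrm{disc}(\mathrm{gd},R)=|\Pr[\mathrm{gd}(\boldsymbol u,\boldsymbol v)=0\text{ and }(\boldsymbol u,\boldsymbol v)\in R]-\Pr[\mathrm{gd}(\boldsymbol u,\boldsymbol v)=1\text{ and }(\boldsymbol u,\boldsymbol v)\in R]|$, and $\mathrm{disc}(\mathrm{gd})=\max_R\mathrm{disc}(\mathrm{gd},R)$. Relative average degree: for $\mathcal{W}\subseteq\Lambda^N$ and $I\subseteq[N]$, let $\mathcal{W}|_{[N]-I}$ be the set of projections of strings of $\mathcal{W}$ to the coordinates outside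 $I$. The degree of $w'\in\Lambda^{[N]-I}$ in $\mathcal{W}$ is the number of extensions of $w'$ to strings in $\mathcal{W}$; $\mathrm{AvgDeg}_I(\mathcal{W})$ is the average degree over all $w'\in\mathcal{W}|_{[N]-I}$, and $\mathrm{rAvgDeg}_I(\mathcal{W})=\mathrm{AvgDeg}_I(\mathcal{W})/|\Lambda|^{|I|}$.
   Formalization: The formal theorem assumes d ≥ 1 (for d = 0 the bound 1/(d·ℓ^d)^{|I|} is undefined) and ℓ ≥ 2 (for ℓ = 1, log ℓ = 0 and the claim fails, e.g. η = 1, d = 2, t = 1, gd = XOR, X = Y = {0}; for ℓ = 0 it is trivial). *)

(* Defs.v *)
From mathcomp Require Export all_boot all_order all_algebra.
From mathcomp Require Export boolp reals exp.

Set Implicit Arguments.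
Unset Strict Implicit.
Unset Printing Implicit Defensive.

Import Order.TTheory GRing.Theory Num.Theory.
Local Open Scope ring_scope.

Lemma ex_asbool (P : nat -> Prop) :
  (exists n, P n) -> exists n, (fun n => `[< P n >]) n.
Proof. by move=> [n Pn]; exists n; apply/asboolP. Qed.

Definition least (P : nat -> Prop) (exP : exists n, P n) : nat :=
  ex_minn (ex_asbool exP).

Record search_problem (Z O : Type) := SearchProblem {
  solution :> Z -> O -> Prop;
  solution_exists : forall z, exists o, solution z o
}.

Section DecisionTrees.
Variables (l : nat) (O : Type).

Inductive dtree : Type :=
  | DLeaf of O
  | DQuery of 'I_l & dtree & dtree.

Fixpoint ddepth (T : dtree) : nat :=
  match T with
  | DLeaf _ => 0
  | DQuery _ T0 T1 => (maxn (ddepth T0) (ddepth T1)).+1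
  end.

Fixpoint deval (T : dtree) (z : {ffun 'I_l -> bool}) : O :=
  match T with
  | DLeaf o => o
  | DQuery i T0 T1 => if z i then deval T1 z else deval T0 z
  end.

Variable S : search_problem {ffun 'I_l -> bool} O.

Definition dtree_solves (T : dtree) : Prop := forall z, S z (deval T z).

Lemma dtree_exists : exists n T, dtree_solves T /\ ddepth T = n.
Proof.
have [f fP] := choice (solution_exists S).
suff [T HT] : exists T, forall z, deval T z = f z.
  by exists (ddepth T), T; split=> // z; rewrite HT.
suff H (s : seq 'I_l) (g : {ffun 'I_l -> bool}) : exists T, forall z,
    deval T z = f [ffun i => if i \in s then z i else g i].
  have [T HT] := H (enum 'I_l) [ffun=> false]; exists T => z; rewrite HT.
  by congr f; apply/ffunP => i; rewrite ffunE mem_enum.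
elim: s g => [|j s IH] g.
  by exists (DLeaf (f g)) => z /=; congr f; apply/ffunP => i; rewrite ffunE.
have [T0 H0] := IH [ffun i => if i == j then false else g i].
have [T1 H1] := IH [ffun i => if i == j then true else g i].
exists (DQuery j T0 T1) => z /=; rewrite H0 H1.
case zj: (z j); congr f; apply/ffunP => i; rewrite !ffunE inE;
  by case: (eqVneq i j) => [->|] //=; rewrite zj; case: ifP.
Qed.

Definition query_complexity : nat := least dtree_exists.

End DecisionTrees.

Section Protocols.
Variables (U V : finType) (O : Type).

Inductive protocol : Type :=
  | PLeaf of O
  | PAlice of (U -> bool) & protocol & protocol
  | PBob of (V -> bool) & protocol & protocol.

Fixpoint pdepth (P : protocol) : nat :=
  match P with
  | PLeaf _ => 0
  | PAlice _ P0 P1 | PBob _ P0 P1 => (maxn (pdepth P0) (pdepth P1)).+1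
  end.

Fixpoint peval (P : protocol) (x : U) (y : V) : O :=
  match P with
  | PLeaf o => o
  | PAlice a P0 P1 => if a x then peval P1 x y else peval P0 x y
  | PBob b P0 P1 => if b y then peval P1 x y else peval P0 x y
  end.

Definition protocol_solves (T : search_problem (U * V) O)
    (X : {set U}) (Y : {set V}) (P : protocol) : Prop :=
  forall x y, x \in X -> y \in Y -> T (x, y) (peval P x y).

Lemma protocol_computes (o0 : O) (f : U * V -> O) :
  exists P, forall x y, peval P x y = f (x, y).
Proof.
have HB x : exists P, forall x' y, peval P x' y = f (x, y).
  suff H (s : seq V) : exists P, forall x' y, y \in s ->
      peval P x' y = f (x, y).
    by have [P HP] := H (enum V); exists P => x' y; apply: HP; rewrite mem_enum.
  elim: s => [|v s [P HP]]; first by exists (PLeaf o0).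
  exists (PBob (fun y => y == v) P (PLeaf (f (x, v)))) => x' y /=.
  by rewrite inE; case: eqVneq => [->|_] //=; apply: HP.
suff H (s : seq U) : exists P, forall x y, x \in s -> peval P x y = f (x, y).
  by have [P HP] := H (enum U); exists P => x y; apply: HP; rewrite mem_enum.
elim: s => [|u s [P HP]]; first by exists (PLeaf o0).
have [Q HQ] := HB u.
exists (PAlice (fun x => x == u) P Q) => x y /=.
by rewrite inE; case: eqVneq => [->|_] //=; apply: HP.
Qed.

End Protocols.

Section Composition.
Variables (L : finType) (l : nat) (O : Type).
Variables (S : search_problem {ffun 'I_l -> bool} O) (g : L -> L -> bool).

Definition gadget_eval (x y : {ffun 'I_l -> L}) : {ffun 'I_l -> bool} :=
  [ffun i => g (x i) (y i)].

Definition compose :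
    search_problem ({ffun 'I_l -> L} * {ffun 'I_l -> L}) O :=
  @SearchProblem _ O (fun xy o => S (gadget_eval xy.1 xy.2) o)
    (fun xy => solution_exists S (gadget_eval xy.1 xy.2)).

Lemma protocol_exists (X Y : {set {ffun 'I_l -> L}}) :
  exists n P, protocol_solves compose X Y P /\ pdepth P = n.
Proof.
have [f fP] := choice (solution_exists compose).
have [o0 _] := solution_exists S [ffun=> false].
have [P HP] := protocol_computes o0 f.
by exists (pdepth P), P; split=> // x y _ _; rewrite HP; apply: fP.
Qed.

Definition comm_complexity (X Y : {set {ffun 'I_l -> L}}) : nat :=
  least (protocol_exists X Y).

End Composition.

Section Discrepancy.
Variables (R : realType) (L : finType) (g : L -> L -> bool).

Definition unif_prob (E : {set L * L}) : R := #|E|%:R / #|{: L * L}|%:R.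

Definition disc_rect (A B : {set L}) : R :=
  `| unif_prob [set uv | (g uv.1 uv.2 == false) && (uv \in setX A B)]
     - unif_prob [set uv | (g uv.1 uv.2 == true) && (uv \in setX A B)] |.

(* The default value 0 is harmless: every [disc_rect A B] is nonnegative. *)
Definition disc : R :=
  \big[Num.max/0]_(AB : {set L} * {set L}) disc_rect AB.1 AB.2.

End Discrepancy.

Section AverageDegree.
Variables (L : finType) (N : nat).

Definition restrict (J : {set 'I_N}) (w : {ffun 'I_N -> L}) :
    {ffun {i : 'I_N | i \in J} -> L} := [ffun i => w (val i)].

Definition proj (J : {set 'I_N}) (W : {set {ffun 'I_N -> L}}) :=
  [set restrict J w | w in W].

Definition degree (I : {set 'I_N}) (W : {set {ffun 'I_N -> L}})
    (w' : {ffun {i : 'I_N | i \in ~: I} -> L}) : nat :=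
  #|[set w in W | restrict (~: I) w == w']|.

Variable R : realType.

(* For empty [W] this is 0 / 0 = 0. *)
Definition avg_deg (I : {set 'I_N}) (W : {set {ffun 'I_N -> L}}) : R :=
  (\sum_(w' in proj (~: I) W) (degree W w')%:R) / #|proj (~: I) W|%:R.

Definition ravg_deg (I : {set 'I_N}) (W : {set {ffun 'I_N -> L}}) : R :=
  avg_deg I W / #|L|%:R ^+ #|I|.

End AverageDegree.

Definition log2 (R : realType) (x : R) : R := ln x / ln 2.

Arguments disc R {L} g.
Arguments ravg_deg {L N} R I W.

(* Main.v *)
(* A decision tree simulates the protocol on a rectangle [X * Y] while keeping
   both sides "spread" on the coordinates it has not queried: no block of
   coordinates takes a fixed value with probability much above [2^-t] per
   coordinate. The average-degree hypothesis implies that the initial sets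
   are spread, with room to spare. When a message makes, say, [X] lose
   spreadness, a maximal heavy block [x_K = b] is fixed, [K] is queried and [Y]
   is conditioned on the answers. This works because most [x] are safe: the
   gadget outputs on [x] are almost uniform over [y], even jointly with a block
   of [y]. Safety is a second-moment bound on the Fourier coefficients of the
   gadget outputs; the fourth power of the box norm of the gadget is at most
   [4 disc(gd)] and tensorizes, which replaces an XOR lemma. Each queried
   coordinate gains a factor [2^Omega(t)] in the density of [X * Y], whereas each
   communicated bit loses a factor at most 4. *)
Require Import Defs.
From mathcomp Require Import ring lra.

Set Implicit Arguments.
Unset Strict Implicit.
Unset Printing Implicit Defensive.

Import Order.TTheory GRing.Theory Num.Theory.
Local Open Scope ring_scope.

(** * Fibers and spread sets *)

Section Fibers.
Variables (T L : finType).
Notation word := {ffun T -> L}.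
Implicit Types (W : {set word}) (I J K : {set T}) (b w : word).

Definition agree K b w := [forall i in K, w i == b i].

Definition fiber W K b := [set w in W | agree K b w].

Definition patch K b w : word := [ffun i => if i \in K then b i else w i].

Lemma agreeP K b w : reflect {in K, forall i, w i = b i} (agree K b w).
Proof. by apply: (iffP forall_inP) => h i /h /eqP. Qed.

Lemma fiber_sub W K b : fiber W K b \subset W.
Proof. by apply/subsetP => w; rewrite inE => /andP[]. Qed.

Lemma fiberS W W' K b : W \subset W' -> fiber W K b \subset fiber W' K b.
Proof.
by move=> /subsetP sW; apply/subsetP => w; rewrite !inE => /andP[/sW-> ->].
Qed.

Lemma eq_fiber W K b b' : {in K, forall i, b i = b' i} ->
  fiber W K b = fiber W K b'.
Proof.
move=> eb; apply/setP => w; rewrite !inE; congr (_ && _).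
by apply/agreeP/agreeP => h i iK; rewrite h // eb.
Qed.

Lemma fiber0 W b : fiber W set0 b = W.
Proof.
by apply/setP => w; rewrite inE; case: agreeP => [|[]] //; rewrite ?andbT // => i; rewrite inE.
Qed.

Lemma fiber_fiber W K K' b b' : [disjoint K & K'] ->
  fiber (fiber W K b) K' b' = fiber W (K :|: K') (patch K b b').
Proof.
move=> dK; apply/setP => w; rewrite !inE -andbA; congr (_ && _).
apply/andP/agreeP => [[/agreeP h /agreeP h'] i|h].
  by rewrite inE ffunE; case: ifP => [/h|_ /= /h'].
split; apply/agreeP => i iK.
  by rewrite h ?inE ?iK // ffunE iK.
by rewrite h ?inE ?iK ?orbT // ffunE (disjointFl dK).
Qed.

Variable R : realFieldType.

(** For [c = #|W|] this is blockwise min-entropy: a uniform word of [W] takes a given value on [K]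
    with probability at most [lam ^+ #|K|]. A separate [c] lets the bound survive the passage to
    subsets of [W]. *)
Definition spread W I (lam c : R) :=
  forall K b, K \subset I -> #|fiber W K b|%:R <= lam ^+ #|K| * c.

Lemma spread_sub W W' I lam c :
  W' \subset W -> spread W I lam c -> spread W' I lam c.
Proof.
move=> sW h K b sK; apply: le_trans (h K b sK).
by rewrite ler_nat subset_leq_card // fiberS.
Qed.

Lemma spread_card W I lam c b : spread W I lam c -> #|W|%:R <= c.
Proof.
by move=> h; have := h set0 b (sub0set _); rewrite fiber0 cards0 expr0 mul1r.
Qed.

(** Among the blocks that violate spreadness take one with [K] largest. A block that is heavy inside
    its fiber would, joined to [K], give a larger violation. *)
Lemma maximal_heavy_fiber W I lam : 0 <= lam -> ~ spread W I lam #|W|%:R ->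
  exists K b, [/\ K \subset I, K != set0,
    lam ^+ #|K| * #|W|%:R < #|fiber W K b|%:R &
    spread (fiber W K b) (I :\: K) lam #|fiber W K b|%:R].
Proof.
pose P (Kb : {set T} * word) :=
  (Kb.1 \subset I) && (lam ^+ #|Kb.1| * #|W|%:R < #|fiber W Kb.1 Kb.2|%:R).
move=> lam0 nW; have [Kb0 PKb0] : exists Kb, P Kb.
  apply: contrapT => nP; apply: nW => K b sK.
  by rewrite leNgt; apply/negP => lt; apply: nP; exists (K, b); rewrite /P sK.
case: (arg_maxnP (fun Kb : {set T} * word => #|Kb.1|) PKb0) => -[K b].
rewrite /P /= => /andP[sK ltK] maxK; exists K, b; split=> //.
  by apply: contraTneq ltK => ->; rewrite fiber0 cards0 mul1r ltxx.
move=> K' b' sK'; have [->|nK'] := eqVneq K' set0.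
  by rewrite fiber0 cards0 mul1r.
move: sK'; rewrite subsetD => /andP[sK' dK].
rewrite fiber_fiber 1?disjoint_sym //.
have cU : #|K :|: K'| = (#|K| + #|K'|)%N.
  by apply/eqP; rewrite (leq_card_setU K K') disjoint_sym.
have := maxK (K :|: K', patch K b b'); rewrite /= subUset sK sK' /=.
rewrite ltNge cU; case: (_ <= _) / idP => [le _|_ /(_ isT)].
  apply: le_trans le _; rewrite exprD mulrAC mulrC ler_wpM2l ?exprn_ge0 //.
  exact: ltW.
by rewrite -{2}[#|K|]addn0 leq_add2l leqn0 cards_eq0 (negPf nK').
Qed.

End Fibers.

(** * Second moment of the gadget characters *)

Section Sums.
Variables (R : realFieldType) (T L : finType).
Notation word := {ffun T -> L}.
Implicit Types (W X Y : {set word}) (S I J K : {set T}) (b w x y : word).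
Local Notation n := (#|L|%:R : R).

Lemma sum_prod_in S (h : T -> L -> R) :
  \sum_(w : word) \prod_(i in S) h i (w i) =
  n ^+ #|~: S| * \prod_(i in S) \sum_u h i u.
Proof.
transitivity (\prod_i \sum_u (if i \in S then h i u else 1)).
  by rewrite bigA_distr_bigA; apply: eq_bigr => w _; rewrite big_mkcond.
rewrite (bigID (mem S)) /= mulrC; congr (_ * _).
  rewrite -prodr_const; apply: eq_big => [i|i /negPf->]; first by rewrite inE.
  by rewrite sumr_const.
by apply: eq_bigr => i ->.
Qed.

Lemma sum_agree S w : \sum_v (agree S w v)%:R = n ^+ #|~: S| :> R.
Proof.
have e v : (agree S w v)%:R = \prod_(i in S) (v i == w i)%:R :> R.
  case: agreeP => [h|h].
    by rewrite big1 // => i /h ->; rewrite eqxx.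
  apply/esym/eqP; apply: contra_notT h => /prodf_neq0 h i iS.
  by apply/eqP; apply: contraNT (h i iS) => /negPf->.
under eq_bigr => v _ do rewrite e.
rewrite (sum_prod_in S (fun i u => (u == w i)%:R)) big1 ?mulr1 // => i _.
by rewrite (bigD1 (w i)) //= eqxx big1 ?addr0 // => u /negPf->.
Qed.

(** Double counting: replace each [w] in [W] by the [n ^+ #|~: S|] words that agree with it on [S].
    A word [v] is then hit once for each member of the fiber over its own values on [S], hence at
    most [c] times. *)
Lemma sum_le_fiber W S (f : word -> R) (c : R) :
  (forall w, 0 <= f w) ->
  (forall w w', {in S, forall i, w i = w' i} -> f w = f w') ->
  (forall b, #|fiber W S b|%:R <= c) ->
  n ^+ #|~: S| * \sum_(w in W) f w <= c * \sum_w f w.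
Proof.
move=> f0 fS hc.
have -> : n ^+ #|~: S| * \sum_(w in W) f w = \sum_v #|fiber W S v|%:R * f v.
  rewrite mulr_sumr (eq_bigr (fun w => \sum_v (agree S w v)%:R * f v)).
    rewrite exchange_big /=; apply: eq_bigr => v _.
    rewrite -mulr_suml; congr (_ * _); rewrite -sum1_card natr_sum.
    rewrite big_mkcond [RHS]big_mkcond; apply: eq_bigr => w _ /=.
    rewrite inE; case: ifP => //= _.
    have -> : agree S w v = agree S v w by apply/agreeP/agreeP => h i /h.
    by case: ifP.
  move=> w _; rewrite -(sum_agree S w) mulr_suml; apply: eq_bigr => v _.
  by case: agreeP => [h|_]; rewrite ?mul0r ?mul1r //; apply: fS => i /h.
rewrite mulr_sumr; apply: ler_sum => v _; exact: ler_wpM2r.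
Qed.

Lemma sum_prod_le_fiber W S (h : T -> L -> R) (c : R) :
  (0 < #|L|)%N -> (forall i u, 0 <= h i u) ->
  (forall b, #|fiber W S b|%:R <= c) ->
  \sum_(w in W) \prod_(i in S) h i (w i) <= c * \prod_(i in S) \sum_u h i u.
Proof.
move=> n0 h0 hc; have pn : 0 < n ^+ #|~: S| by rewrite exprn_gt0 ?ltr0n.
rewrite -(ler_pM2l pn) mulrCA -sum_prod_in; apply: sum_le_fiber => //.
  by move=> w; apply: prodr_ge0.
by move=> w w' e; apply: eq_bigr => i iS; rewrite e.
Qed.

(** Cauchy-Schwarz against the constant 1, read off from the nonnegative double sum of squared
    differences. *)
Lemma sqr_sum_le (J : finType) (A : {set J}) (f : J -> R) :
  (\sum_(i in A) f i) ^+ 2 <= #|A|%:R * \sum_(i in A) f i ^+ 2.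
Proof.
have : 0 <= \sum_(i in A) \sum_(j in A) (f i - f j) ^+ 2.
  by apply: sumr_ge0 => i _; apply: sumr_ge0 => j _; apply: sqr_ge0.
rewrite (eq_bigr (fun i => #|A|%:R * f i ^+ 2 + \sum_(j in A) f j ^+ 2
   - 2 * (f i * \sum_(j in A) f j))) => [|i iA].
  rewrite big_split /= sumrN big_split /= -!mulr_sumr -mulr_suml.
  rewrite sumr_const -mulr_natl -expr2; lra.
rewrite (eq_bigr (fun j => f i ^+ 2 + f j ^+ 2 - 2 * (f i * f j))); last first.
  by move=> j _; ring.
rewrite big_split /= sumrN big_split /= sumr_const -!mulr_sumr.
by rewrite -[f i ^+ 2 *+ _]mulr_natl.
Qed.

Lemma sum_subset_expr (x : R) (A : {set T}) :
  \sum_(S : {set T} | S \subset A) x ^+ #|S| = (1 + x) ^+ #|A|.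
Proof.
have -> : (1 + x) ^+ #|A| = \prod_(i : T) ((if i \in A then x else 0) + 1).
  rewrite -prodr_const big_mkcond; apply: eq_bigr => i _.
  by case: ifP; rewrite ?add0r // addrC.
rewrite bigA_distr big_mkcond; apply: eq_bigr => S _ /=.
rewrite -big_mkcond /=; case: ifP => [/subsetP sA|/negbT/subsetPn[i iS niA]].
  by rewrite -prodr_const; apply: eq_bigr => i /sA->.
by rewrite (bigD1 i) //= (negPf niA) mul0r.
Qed.

Lemma prod_1add_subset (a : T -> R) (J : {set T}) :
  \prod_(i in J) (1 + a i) = \sum_(S : {set T} | S \subset J) \prod_(i in S) a i.
Proof.
have -> : \prod_(i in J) (1 + a i) =
    \prod_(i : T) ((if i \in J then a i else 0) + 1).
  rewrite big_mkcond; apply: eq_bigr => i _.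
  by case: ifP; rewrite ?add0r // addrC.
rewrite bigA_distr [RHS]big_mkcond; apply: eq_bigr => S _ /=.
rewrite -big_mkcond /=; case: ifP => [/subsetP sA|/negbT/subsetPn[i iS niA]].
  by apply: eq_bigr => i /sA->.
by rewrite (bigD1 i) //= (negPf niA) mul0r.
Qed.

End Sums.

Section Characters.
Variables (R : realFieldType) (T L : finType).
Notation word := {ffun T -> L}.
Implicit Types (W X Y : {set word}) (S I J K : {set T}) (b w x y : word).
Local Notation n := (#|L|%:R : R).

Definition sgn (g : L -> L -> bool) u v : R := (-1) ^+ g u v.

Definition chi g S x y : R := \prod_(i in S) sgn g (x i) (y i).

(** The fourth power of the box norm of the sign matrix, without the normalization by [n ^+ 4]. *)
Definition box (g : L -> L -> bool) : R :=
  \sum_v \sum_v' (\sum_u sgn g u v * sgn g u v') ^+ 2.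

Definition flip (A B C : Type) (f : A -> B -> C) (v : B) (u : A) := f u v.

(** With the square expanded, both sides sum the product of the four signs at the corners of all
    combinatorial squares [u, u', v, v'], which is symmetric in the two players. *)
Lemma box_flip g : box (flip g) = box g.
Proof.
have e h : box h = \sum_v \sum_v' \sum_u \sum_u'
    sgn h u v * sgn h u v' * (sgn h u' v * sgn h u' v').
  apply: eq_bigr => v _; apply: eq_bigr => v' _.
  rewrite expr2 mulr_suml; apply: eq_bigr => u _.
  by rewrite mulr_sumr; apply: eq_bigr => u' _.
rewrite !e [RHS](eq_bigr (fun v => \sum_u \sum_v' \sum_u'
    sgn g u v * sgn g u v' * (sgn g u' v * sgn g u' v'))).
  rewrite [RHS]exchange_big /=; apply: eq_bigr => u _.
  rewrite (eq_bigr (fun v' => \sum_u' \sum_v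
    sgn g u u' * sgn g u v * (sgn g v' u' * sgn g v' v))) => [|v' _].
    rewrite exchange_big /=; apply: eq_bigr => u' _.
    by rewrite exchange_big.
  by apply: eq_bigr => u' _; apply: eq_bigr => v _; rewrite /sgn /flip; ring.
by move=> v _; rewrite exchange_big.
Qed.

(** The unnormalized Fourier coefficient at [S] of the gadget outputs on [x], for [y] ranging over
    the part of [Y] with block [K] fixed to [b]. *)
Definition bias g Y S K b x : R := \sum_(y in fiber Y K b) chi g S x y.

Lemma norm_chi g S x y : `|chi g S x y| = 1.
Proof.
rewrite normr_prod big1 // => i _; by rewrite /sgn normrX normrN1 expr1n.
Qed.

Lemma bias_le_card g Y S K b x : `|bias g Y S K b x| <= #|fiber Y K b|%:R.
Proof.
apply: le_trans (ler_norm_sum _ _ _) _.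
by under eq_bigr => y _ do rewrite norm_chi; rewrite sumr_const.
Qed.

(* Cauchy-Schwarz over the pairs y, y' separates the coordinates, each of which
   contributes a factor [box g]. *)
Lemma bias_second_moment g X Y S K b (cx ck cy gam : R) :
  (0 < #|L|)%N -> 0 <= gam -> box g <= (gam * n ^+ 2) ^+ 2 -> 
  (forall a, #|fiber X S a|%:R <= cx) ->
  #|fiber Y K b|%:R <= ck ->
  (forall a, #|fiber (fiber Y K b) S a|%:R <= cy) -> 0 <= cy -> 0 <= cx ->
  \sum_(x in X) bias g Y S K b x ^+ 2 <= cx * (ck * cy * (gam * n ^+ 2) ^+ #|S|).
Proof.
move=> n0 g0 hbox hx hk hy cy0 cx0.
have pn : 0 < n ^+ #|~: S| by rewrite exprn_gt0 ?ltr0n.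
set Z := fiber Y K b in hk hy *.
pose N v v' := \sum_u sgn g u v * sgn g u v'.
pose G (p : word * word) := \prod_(i in S) N (p.1 i) (p.2 i).
have e : \sum_x bias g Y S K b x ^+ 2 =
    n ^+ #|~: S| * \sum_(p in setX Z Z) G p.
  rewrite (eq_bigr (fun x => \sum_(p in setX Z Z) chi g S x p.1 * chi g S x p.2)).
    rewrite exchange_big mulr_sumr; apply: eq_bigr => p _ /=.
    under eq_bigr => x _ do rewrite -big_split /=.
    by rewrite (sum_prod_in S (fun i u => sgn g u (p.1 i) * sgn g u (p.2 i))).
  move=> x _; rewrite expr2 big_distrlr /= pair_big /=.
  by apply: eq_bigl => p; rewrite [RHS]inE.
have hG : \sum_(p in setX Z Z) G p <= ck * cy * (gam * n ^+ 2) ^+ #|S|.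
  apply: le_trans (ler_norm _) _.
  have r0 : 0 <= ck * cy * (gam * n ^+ 2) ^+ #|S|.
    rewrite !mulr_ge0 ?exprn_ge0 ?mulr_ge0 ?exprn_ge0 //.
    exact: le_trans hk.
  rewrite -ler_sqr ?nnegrE // real_normK ?num_real //.
  apply: le_trans (sqr_sum_le _ _) _.
  rewrite cardsX natrM.
  have -> : \sum_(p in setX Z Z) G p ^+ 2 =
      \sum_(y in Z) \sum_(y' in Z) \prod_(i in S) N (y i) (y' i) ^+ 2.
    rewrite pair_big; apply: eq_big => [p|p _]; first by rewrite [LHS]inE.
    by rewrite /G prodrXl.
  (* The sum over [y'] and then the sum over [y] are bounded by products of sums over single
     letters, each at the cost of a factor [cy]; every coordinate of [S] then yields one [box g]. *)
  have le2 : \sum_(y in Z) \sum_(y' in Z) \prod_(i in S) N (y i) (y' i) ^+ 2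
      <= cy * (cy * box g ^+ #|S|).
    apply: (@le_trans _ _ (\sum_(y in Z)
       cy * \prod_(i in S) \sum_v' N (y i) v' ^+ 2)).
      apply: ler_sum => y _.
      by apply: (sum_prod_le_fiber (h := fun i u => N (y i) u ^+ 2)) => // *;
        apply: sqr_ge0.
    rewrite -mulr_sumr ler_wpM2l //.
    apply: le_trans (sum_prod_le_fiber
      (h := fun i u => \sum_v' N u v' ^+ 2) n0 _ hy) _.
      by move=> *; apply: sumr_ge0 => *; apply: sqr_ge0.
    by rewrite prodr_const.
  have box0 : 0 <= box g.
    by apply: sumr_ge0 => *; apply: sumr_ge0 => *; apply: sqr_ge0.
  apply: (@le_trans _ _ (ck * ck * (cy * (cy * ((gam * n ^+ 2) ^+ 2) ^+ #|S|)))).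
    apply: ler_pM => //; rewrite ?mulr_ge0 //.
    - by apply: sumr_ge0 => *; apply: sumr_ge0 => *; apply: prodr_ge0 => *; apply: sqr_ge0.
    - by apply: ler_pM.
    - by apply: le_trans le2 _; rewrite !ler_wpM2l //
        lerXn2r // nnegrE exprn_ge0 // mulr_ge0 ?exprn_ge0.
  rewrite -exprM mulnC exprM; set z := (gam * _) ^+ _.
  by rewrite le_eqVlt; apply/orP; left; apply/eqP; ring.
(* [bias] reads [x] only on [S], so the sum over [X] is controlled by the sum over all words
   computed in [e]. *)
rewrite -(ler_pM2l pn); apply: le_trans.
  apply: (@sum_le_fiber _ _ _ X S (fun x => bias g Y S K b x ^+ 2) cx) => //.
  - by move=> *; apply: sqr_ge0.
  - move=> w w' h; congr (_ ^+ 2); apply: eq_bigr => y _; apply: eq_bigr => i iS.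
    by rewrite h.
by rewrite e mulrCA ler_wpM2l ?(ltW pn) // ler_wpM2l.
Qed.

End Characters.

(** * Safe inputs *)

Section Safety.
Variables (R : realFieldType) (T L : finType).
Notation word := {ffun T -> L}.
Implicit Types (W X Y : {set word}) (S I J K : {set T}) (b w x y : word).
Implicit Types (g : L -> L -> bool) (z : {ffun T -> bool}).
Local Notation n := (#|L|%:R : R).
Local Notation l := (#|T|%:R : R).

Definition cond g Y J x z :=
  [set y in Y | [forall i in J, g (x i) (y i) == z i]].

Lemma cond_sub g Y J x z : cond g Y J x z \subset Y.
Proof. by apply/subsetP => y; rewrite inE => /andP[]. Qed.

(** Fourier expansion of the event that the outputs on [J] equal [z]: its indicator times
    [2 ^+ #|J|] is the product over [J] of one plus the signed gadget value. *)
Lemma card_fiber_cond g Y J K x z b :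
  2 ^+ #|J| * #|fiber (cond g Y J x z) K b|%:R =
  \sum_(S : {set T} | S \subset J)
     (\prod_(i in S) (-1) ^+ z i) * bias R g Y S K b x.
Proof.
have e y : \prod_(i in J) (1 + (-1) ^+ z i * sgn R g (x i) (y i)) =
    2 ^+ #|J| * [forall i in J, g (x i) (y i) == z i]%:R.
  have e2 i : 1 + (-1) ^+ z i * sgn R g (x i) (y i) =
      2 * (g (x i) (y i) == z i)%:R.
    by rewrite /sgn; case: (z i) (g _ _) => -[]; rewrite /= ?expr0 ?expr1; ring.
  under eq_bigr => i _ do rewrite e2.
  rewrite big_split prodr_const; congr (_ * _).
  case: forall_inP => [h|/forall_inP/forall_inPn[i iJ ne]].
    by rewrite big1 // => i /h ->.
  by rewrite (bigD1 i) //= (negPf ne) mul0r.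
transitivity (\sum_(y in fiber Y K b)
    \prod_(i in J) (1 + (-1) ^+ z i * sgn R g (x i) (y i))).
  under [RHS]eq_bigr => y _ do rewrite e.
  rewrite -mulr_sumr; congr (_ * _).
  rewrite -sum1_card natr_sum big_mkcond [RHS]big_mkcond.
  by apply: eq_bigr => y _; rewrite !inE; case: (y \in Y);
    case: (agree K b y); case: [forall _ in _, _].
under eq_bigr => y _ do rewrite prod_1add_subset.
rewrite exchange_big; apply: eq_bigr => S _.
by rewrite mulr_sumr; apply: eq_bigr => y _; rewrite -big_split.
Qed.

(** Induction gives [(1 + a) ^+ k * (1 - k%:R * a) <= 1], and [k%:R * a <= 1 / 4] makes the second
    factor at least 3/4. *)
Lemma one_add_expr_le (a : R) (k p : nat) :
  0 <= a -> 4 * p%:R * a <= 1 -> (k <= p)%N -> (1 + a) ^+ k <= 4 / 3.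
Proof.
move=> a0 ha kp.
have h : (1 + a) ^+ k * (1 - k%:R * a) <= 1.
  elim: k {kp} => [|k]; first by rewrite expr0 mul0r; lra.
  apply: le_trans; rewrite exprS -mulrA mulrCA ler_wpM2l ?exprn_ge0 //.
    by rewrite addr_ge0.
  rewrite -natr1.
  have : 0 <= (k%:R + 1) * a * a by rewrite !mulr_ge0 // addr_ge0.
  nra.
have hk : k%:R * a <= p%:R * a by rewrite ler_wpM2r // ler_nat.
have h0 : 0 <= (1 + a) ^+ k by rewrite exprn_ge0 // addr_ge0.
nra.
Qed.

Lemma card_bigcup_le (J A : finType) (P : pred J) (E : J -> {set A}) :
  (#|\bigcup_(i | P i) E i| <= \sum_(i | P i) #|E i|)%N.
Proof.
elim/big_rec2: _ => [|i k W _ le]; first by rewrite cards0.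
by rewrite (leq_trans (leq_card_setU _ _)) // leq_add2l.
Qed.

Variables (m : nat) (lam B gam v : R).

(** Strongly spread sets have rate [lam], weakly spread ones [B * lam]. Each answer [z] on [J] must
    keep at least half of its fair share [2 ^- #|J|] of [Y], and leave that part weakly spread. *)
Definition safe g Y I x := forall J z, J \subset I ->
  #|Y|%:R <= 2 ^+ #|J|.+1 * #|cond g Y J x z|%:R :> R /\
  spread (cond g Y J x z) (I :\: J) (B * lam) #|cond g Y J x z|%:R.

(* The factor [(4 * l) ^- #|S|] makes the sum over all [S \subset J] at most a
   constant. *)
Definition threshold Y S K : R :=
  (B * lam) ^+ #|K| / 2 * (4 * l) ^- #|S| * #|Y|%:R.

Definition unbiased g Y I x :=
  [forall S : {set T}, forall K : {set T}, forall b,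
    [&& S \subset I, S != set0, K \subset I & [disjoint S & K]] ==>
    (`|bias R g Y S K b x| <= threshold Y S K)].

Hypotheses (n0 : (0 < #|L|)%N) (l0 : (0 < #|T|)%N) (m0 : (0 < m)%N).
Hypotheses (lam0 : 0 < lam) (gam0 : 0 <= gam) (v1 : 1 <= v).
Hypothesis hB : (8 * l) ^+ m <= B.
(** A single coefficient at [S] will turn out to exceed its threshold on at most a fraction
    [rate ^+ #|S|] of [X]. The extra [v] in [hrate] leaves room for the union bound over blocks and
    their values. *)
Local Notation rate := (64 * l ^+ 2 * (B * lam) * lam * n ^+ 2 * gam).
Hypothesis hrate : 4 * l * (rate * v) <= 1.
(* In the union bound below only the [K] with [m * #|K| < #|S|] matter, so [v ^+ m]
   pays for the [n] values of each coordinate of [K]. *)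
Hypothesis hv : 4 * l * n <= v ^+ m.

Let pl : 1 <= l. Proof. by rewrite ler1n. Qed.

Let hB8 : 8 <= B.
Proof.
have pl1 := pl.
apply: le_trans hB; apply: (@le_trans _ _ (8 * l)); first by move: pl; lra.
by rewrite -[leLHS]expr1 ler_weXn2l //; lra.
Qed.

Let Blam0 : 0 <= B * lam. Proof. by rewrite mulr_ge0 ?(ltW lam0) //; move: hB8; lra. Qed.

Let l4 : 0 < 4 * l. Proof. move: pl; lra. Qed.

(** In the Fourier expansion the empty [S] contributes [#|fiber Y K b|], the value for uniform
    outputs. The other terms are below their thresholds, whose weights [(4 * l) ^- #|S|] add up to
    at most 4/3 - 1. *)
Lemma unbiased_fiber_cond g Y I J K x z b :
  unbiased g Y I x -> J \subset I -> K \subset I :\: J ->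
  `|2 ^+ #|J| * #|fiber (cond g Y J x z) K b|%:R - #|fiber Y K b|%:R|
  <= (B * lam) ^+ #|K| / 2 * #|Y|%:R / 3.
Proof.
have pl1 := pl; have B8 := hB8; have Bl0 := Blam0; have pl4 := l4.
move=> ub sJ; rewrite subsetD => /andP[sK dK].
have h0 : 0 <= (B * lam) ^+ #|K| / 2 * #|Y|%:R.
  by rewrite !mulr_ge0 ?exprn_ge0 // invr_ge0.
rewrite card_fiber_cond (bigD1 set0) ?sub0set //= big_set0 mul1r.
have -> : bias R g Y set0 K b x = #|fiber Y K b|%:R.
  by rewrite /bias; under eq_bigr do rewrite /chi big_set0; rewrite sumr_const.
rewrite addrAC subrr add0r; apply: le_trans (ler_norm_sum _ _ _) _.
apply: (@le_trans _ _ (\sum_(S : {set T} | (S \subset J) && (S != set0))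
   (B * lam) ^+ #|K| / 2 * #|Y|%:R * ((4 * l)^-1) ^+ #|S|)).
  apply: ler_sum => S /andP[sS nS].
  rewrite normrM normr_prod big1 => [|i _]; last by rewrite normrX normrN1 expr1n.
  move: ub => /forallP/(_ S)/forallP/(_ K)/forallP/(_ b)/implyP.
  rewrite (subset_trans sS) // nS sK (disjointWl sS) 1?disjoint_sym // mul1r.
  by move=> /(_ isT)/le_trans-> //; rewrite /threshold exprVn mulrAC.
rewrite -mulr_sumr ler_wpM2l //.
have := sum_subset_expr ((4 * l)^-1) J.
rewrite (bigD1 set0) ?sub0set //= cards0 expr0 => e.
have : (1 + (4 * l)^-1) ^+ #|J| <= 4 / 3.
  apply: (@one_add_expr_le _ _ #|T|); rewrite ?max_card //.
    by rewrite invr_ge0; lra.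
  by rewrite divff //; lra.
rewrite -e; lra.
Qed.

(** Up to the factor [2 ^+ #|J|], the conditioned set has at least 5/6 of [#|Y|] elements (empty
    [K]), and its fiber over a nonempty [K] at most a fraction 1/8 + 1/6 of
    [(B * lam) ^+ #|K| * #|Y|]. *)
Lemma unbiased_safe g Y I x :
  spread Y I lam #|Y|%:R -> unbiased g Y I x -> safe g Y I x.
Proof.
have pl1 := pl; have B8 := hB8; have Bl0 := Blam0; have pl4 := l4.
move=> spY ub J z sJ.
have hY : #|Y|%:R <= 2 ^+ #|J|.+1 * #|cond g Y J x z|%:R :> R.
  have := unbiased_fiber_cond z x ub sJ (sub0set _).
  rewrite !fiber0 cards0 expr0 ler_norml => /andP[h _].
  have Y0 : 0 <= #|Y|%:R :> R by [].
  by rewrite exprS -[leRHS]mulrA; move: h; set c := 2 ^+ _ * _; lra.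
split=> // K b sK; have [->|nK] := eqVneq K set0.
  by rewrite fiber0 cards0 mul1r.
have := unbiased_fiber_cond z b ub sJ sK.
rewrite ler_norml => /andP[_ h].
have sKI : K \subset I by move: sK; rewrite subsetD => /andP[].
have hk := spY K b sKI.
have hq : 8 * lam ^+ #|K| <= (B * lam) ^+ #|K|.
  rewrite exprMn ler_wpM2r ?exprn_ge0 ?(ltW lam0) //.
  apply: (@le_trans _ _ B) => //.
  by rewrite -[leLHS]expr1 ler_weXn2l ?card_gt0 //; lra.
have p0 : 0 < 2 ^+ #|J| :> R by rewrite exprn_gt0.
have := unbiased_fiber_cond z x ub sJ (sub0set _).
rewrite !fiber0 cards0 expr0 ler_norml => /andP[hlow _].
rewrite -(ler_pM2l p0) mulrCA.
have hp : 0 <= (B * lam) ^+ #|K| by rewrite exprn_ge0.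
have hY0 : 0 <= #|Y|%:R :> R by [].
move: hp hY0 hq h hk hlow; set p := (B * lam) ^+ _; set q := lam ^+ _.
set c := 2 ^+ _ * #|cond _ _ _ _ _|%:R; nra.
Qed.

(* If [K] is not much smaller than [S], already the fibre over [K] is below the
   threshold. *)
Lemma bias_le_threshold g Y I S K b x : spread Y I lam #|Y|%:R ->
  S != set0 -> K \subset I -> (#|S| <= m * #|K|)%N ->
  `|bias R g Y S K b x| <= threshold Y S K.
Proof.
have pl1 := pl; have B8 := hB8; have Bl0 := Blam0; have pl4 := l4.
move=> spY nS sK le; apply: le_trans (bias_le_card R g Y S K b x) _.
apply: le_trans (spY K b sK) _; rewrite ler_wpM2r //.
have s0 : (0 < #|S|)%N by rewrite card_gt0.
have hs : 2 * (4 * l) ^+ #|S| <= B ^+ #|K|.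
  apply: (@le_trans _ _ ((8 * l) ^+ #|S|)).
    have -> : 8 * l = 2 * (4 * l) by ring.
    rewrite [leRHS]exprMn ler_wpM2r ?exprn_ge0 //; first lra.
    by rewrite -[leLHS]expr1 ler_weXn2l //; lra.
  apply: (@le_trans _ _ (((8 * l) ^+ m) ^+ #|K|)).
    by rewrite -exprM ler_weXn2l //; lra.
  by rewrite lerXn2r ?nnegrE ?exprn_ge0 //; lra.
have p0 : 0 < (4 * l) ^+ #|S| by rewrite exprn_gt0 //; lra.
rewrite ler_pdivlMr // [(B * lam) ^+ _]exprMn.
have : 0 <= lam ^+ #|K| by rewrite exprn_ge0 // ltW.
by move=> q0; have := ler_wpM2l q0 hs; rewrite mulrCA [_ * B ^+ _]mulrC; lra.
Qed.

(** Chebyshev: the number of biased [x] times the squared threshold is at most the second moment,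
    whose caps come from the spreadness of [X] over [S] and of [Y] over [K] and [K :|: S]. *)
Lemma card_biased g X Y I S K b : box R g <= (gam * n ^+ 2) ^+ 2 ->
  spread X I (B * lam) #|X|%:R -> spread Y I lam #|Y|%:R ->
  S \subset I -> S != set0 -> K \subset I -> [disjoint S & K] ->
  #|[set x in X | threshold Y S K < `|bias R g Y S K b x|]|%:R
  <= rate ^+ #|S| * #|X|%:R.
Proof.
have pl1 := pl; have B8 := hB8; have Bl0 := Blam0; have pl4 := l4.
move=> hbox spX spY sS nS sK dSK; set E := [set x in X | _].
have s0 : (0 < #|S|)%N by rewrite card_gt0.
have B0 : 0 < B by lra.
have [Y0|Yn0] := eqVneq Y set0.
  have -> : E = set0.
    apply/setP => x; rewrite !inE /threshold Y0 cards0 mulr0.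
    suff -> : bias R g set0 S K b x = 0 by rewrite normr0 ltxx andbF.
    by rewrite /bias big1 // => y; rewrite !inE.
  rewrite cards0 mulr_ge0 // exprn_ge0 // !mulr_ge0 ?exprn_ge0 // ?ltW //; lra.
have pY : 0 < #|Y|%:R :> R by rewrite ltr0n card_gt0.
have := @bias_second_moment R T L g X Y S K b
  ((B * lam) ^+ #|S| * #|X|%:R) (lam ^+ #|K| * #|Y|%:R)
  (lam ^+ (#|K| + #|S|) * #|Y|%:R) gam n0 gam0 hbox.
move=> /(_ (fun a => spX S a sS) (spY K b sK)).
have hy a : #|fiber (fiber Y K b) S a|%:R <= lam ^+ (#|K| + #|S|) * #|Y|%:R.
  rewrite fiber_fiber 1?disjoint_sym //.
  have <- : #|K :|: S| = (#|K| + #|S|)%N.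
    by apply/eqP; rewrite (leq_card_setU K S) disjoint_sym.
  by apply: spY; rewrite subUset sK.
move=> /(_ hy).
have l1 : 0 <= lam by exact: ltW.
rewrite !mulr_ge0 ?exprn_ge0 ?mulr_ge0 // ?(ltW B0) // => /(_ isT isT) mom.
have t0 : 0 < threshold Y S K.
  by rewrite !mulr_gt0 ?invr_gt0 ?exprn_gt0 ?mulr_gt0 //; lra.
have low : #|E|%:R * threshold Y S K ^+ 2 <= \sum_(x in X) bias R g Y S K b x ^+ 2.
  rewrite mulr_natl -sumr_const.
  apply: (@le_trans _ _ (\sum_(x in E) bias R g Y S K b x ^+ 2)).
    apply: ler_sum => x; rewrite inE => /andP[_ lt].
    rewrite -[leRHS]real_normK ?num_real // lerXn2r ?nnegrE //; exact: ltW.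
  rewrite [leRHS](big_setID E) /= (setIidPr _) ?lerDl.
    by apply: sumr_ge0 => x _; apply: sqr_ge0.
  by apply/subsetP => x; rewrite inE => /andP[].
rewrite -(ler_pM2r (exprn_gt0 2 t0)); apply: le_trans low (le_trans mom _).
(* Of the constant [64 * l ^+ 2] in the rate, the part [16 * l ^+ 2] cancels the squared weight
   [(4 * l) ^- #|S|]; the remaining [4 ^+ #|S|] pays for the square of 1/2, as [S] is nonempty. *)
have -> : rate ^+ #|S| * #|X|%:R * threshold Y S K ^+ 2 =
    (4 ^+ #|S| / 4) * ((B * lam) ^+ #|K|) ^+ 2 * #|Y|%:R ^+ 2 *
    ((B * lam) ^+ #|S| * lam ^+ #|S| * (gam * n ^+ 2) ^+ #|S|) * #|X|%:R.
  have -> : rate = (4 * l) ^+ 2 * (4 * ((B * lam) * lam * (gam * n ^+ 2))).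
    by ring.
  rewrite (exprMn _ ((4 * l) ^+ 2)) [_ ^+ 2 ^+ #|S|]exprAC (exprMn _ 4 (_ * _)).
  rewrite (exprMn _ (B * lam * lam)) (exprMn _ (B * lam)) /threshold.
  have : (4 * l) ^+ #|S| != 0 by rewrite lt0r_neq0 // exprn_gt0.
  set a := _ ^+ #|S|; set c := (B * lam) ^+ #|S|; set d := (B * lam) ^+ _.
  set e := (gam * _) ^+ _; set h := 4 ^+ _; set k := lam ^+ _ => a0.
  by field.
set u := (gam * n ^+ 2) ^+ #|S|; set c := (B * lam) ^+ #|S|.
have -> : c * #|X|%:R * (lam ^+ #|K| * #|Y|%:R * (lam ^+ (#|K| + #|S|) * #|Y|%:R) * u)
  = 1 * (lam ^+ #|K|) ^+ 2 * #|Y|%:R ^+ 2 * (c * lam ^+ #|S| * u) * #|X|%:R.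
  by rewrite exprD; ring.
have u0 : 0 <= u by rewrite exprn_ge0 // mulr_ge0 ?exprn_ge0.
have c0 : 0 <= c by rewrite exprn_ge0.
have cu0 : 0 <= c * lam ^+ #|S| * u by rewrite !mulr_ge0 // exprn_ge0.
rewrite ler_wpM2r // ler_wpM2r // ler_wpM2r ?exprn_ge0 //.
apply: ler_pM; rewrite ?exprn_ge0 //.
  by rewrite ler_pdivlMr // mul1r -[leLHS]expr1 ler_weXn2l //; lra.
rewrite lerXn2r ?nnegrE ?exprn_ge0 // lerXn2r ?nnegrE //.
by rewrite ler_peMl //; lra.
Qed.

(** Union bound over [S], [K] and the values on [K]. The blocks cost a factor at most 4/3 and the
    sum over nonempty [S] is at most 1/3, so the unsafe fraction is at most 4/9. *)
Lemma exists_safe_half g X Y I : box R g <= (gam * n ^+ 2) ^+ 2 ->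
  spread X I (B * lam) #|X|%:R -> spread Y I lam #|Y|%:R ->
  exists X', [/\ X' \subset X, #|X|%:R <= 2 * #|X'|%:R :> R &
    forall x, x \in X' -> safe g Y I x].
Proof.
have pl1 := pl; have B8 := hB8; have Bl0 := Blam0; have pl4 := l4.
move=> hbox spX spY; exists [set x in X | unbiased g Y I x]; split.
- by apply/subsetP => x; rewrite inE => /andP[].
- set X' := [set x in X | _].
  have [u0 _] : exists u : L, True by move/card_gt0P: n0 => [u _]; exists u.
  pose Bd S K b := [set x in X | threshold Y S K < `|bias R g Y S K b x|].
  pose PS S := (S \subset I) && (S != set0).
  pose PK S K := [&& K \subset I, [disjoint S & K] & (m * #|K| < #|S|)%N].
  pose W := \bigcup_(S | PS S) \bigcup_(K | PK S K)
    \bigcup_(b in pffun_on u0 K predT) Bd S K b.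
  have sW : X :\: X' \subset W.
    apply/subsetP => x; rewrite !inE => /andP[nub xX].
    move: nub; rewrite xX /= => /forallPn[S /forallPn[K /forallPn[b]]].
    rewrite negb_imply => /andP[/and4P[sS nS sK dSK]]; rewrite -ltNge => lt.
    have mk : (m * #|K| < #|S|)%N.
      rewrite ltnNge; apply: contraL lt => le; rewrite -leNgt.
      exact: bias_le_threshold spY nS sK le.
    apply/bigcupP; exists S; first by rewrite /PS sS.
    apply/bigcupP; exists K; first by rewrite /PK sK dSK.
    (* The bias depends on [b] only through [K], so resetting [b] to [u0] elsewhere leaves just
       [n ^+ #|K|] values to count. *)
    pose b' : word := patch K b [ffun=> u0].
    apply/bigcupP; exists b'.
      apply/pffun_onP; split=> //; apply/supportP => i iK.
      by rewrite !ffunE (negPf iK).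
    rewrite inE xX; suff -> : bias R g Y S K b' x = bias R g Y S K b x by [].
    by rewrite /bias (@eq_fiber _ _ _ _ b' b) // => i iK; rewrite ffunE iK.
  have pv : 0 < v := lt_le_trans ltr01 v1.
  have vm : 0 < v ^+ m by rewrite exprn_gt0.
  have r0 : 0 <= rate.
    by rewrite !mulr_ge0 ?exprn_ge0 // ?(ltW lam0) //; lra.
  have rv0 : 0 <= rate * v by rewrite mulr_ge0 // ltW.
  have cW : #|W|%:R <= \sum_(S | PS S) \sum_(K | PK S K)
      n ^+ #|K| * (rate ^+ #|S| * #|X|%:R).
    apply: (@le_trans _ _ (\sum_(S | PS S) \sum_(K | PK S K)
       \sum_(b in pffun_on u0 K predT) #|Bd S K b|)%N%:R).
      rewrite ler_nat; apply: leq_trans (card_bigcup_le _ _) _.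
      apply: leq_sum => S _; apply: leq_trans (card_bigcup_le _ _) _.
      by apply: leq_sum => K _; apply: card_bigcup_le.
    rewrite natr_sum; apply: ler_sum => S /andP[sS nS].
    rewrite natr_sum; apply: ler_sum => K /and3P[sK dSK _].
    rewrite natr_sum.
    apply: (@le_trans _ _ (\sum_(b in pffun_on u0 K predT)
        rate ^+ #|S| * #|X|%:R)).
      by apply: ler_sum => b _; apply: (card_biased b hbox spX spY).
    rewrite sumr_const card_pffun_on -[leLHS]mulr_natl natrX.
    by rewrite (eq_card (B := L)).
  have inner S : PS S -> \sum_(K | PK S K) n ^+ #|K| * (rate ^+ #|S| * #|X|%:R)
      <= (rate * v) ^+ #|S| * #|X|%:R * (4 / 3).
    (* Inserting [v ^+ #|S| / v ^+ (m * #|K|)], which is at least 1 for these [K], allows the sum to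
       run over all [K], where it is a binomial expansion. *)
    move=> _; apply: (@le_trans _ _ (\sum_(K : {set T} | K \subset [set: T])
       (rate * v) ^+ #|S| * #|X|%:R * (n / v ^+ m) ^+ #|K|)).
      rewrite [leRHS](bigID (PK S)) /= ler_wpDr //.
        by apply: sumr_ge0 => K _; rewrite !mulr_ge0 ?exprn_ge0 ?divr_ge0 // ltW.
      rewrite [leRHS](eq_bigl (PK S)) => [|K]; last by rewrite subsetT.
      apply: ler_sum => K /and3P[_ _ mk].
      have -> : (rate * v) ^+ #|S| * #|X|%:R * (n / v ^+ m) ^+ #|K| =
          n ^+ #|K| * (rate ^+ #|S| * #|X|%:R) * (v ^+ #|S| / v ^+ (m * #|K|)).
        rewrite (exprMn _ rate) (exprMn _ n) exprVn -exprM.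
        by set p := rate ^+ _; set q := (v ^+ (m * _))^-1; ring.
      rewrite ler_peMr ?mulr_ge0 ?exprn_ge0 //.
      rewrite ler_pdivlMr ?exprn_gt0 //.
      by rewrite mul1r ler_weXn2l // ltnW.
    rewrite -mulr_sumr sum_subset_expr ler_wpM2l ?mulr_ge0 ?exprn_ge0 //.
    apply: (@one_add_expr_le _ _ #|T|); rewrite ?max_card ?divr_ge0 ?(ltW vm) //.
    by rewrite mulrA ler_pdivrMr // mul1r.
  have cW2 : #|W|%:R <= #|X|%:R / 2 :> R.
    apply: le_trans cW (le_trans (ler_sum _ inner) _).
    rewrite -mulr_suml -mulr_suml.
    have hs : \sum_(S | PS S) (rate * v) ^+ #|S| <= 1 / 3.
      apply: (@le_trans _ _ (\sum_(S : {set T} |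
          (S \subset [set: T]) && (S != set0)) (rate * v) ^+ #|S|)).
        rewrite [leRHS](bigID (fun S => S \subset I)) /= ler_wpDr //.
          by apply: sumr_ge0 => S _; rewrite exprn_ge0.
        rewrite le_eqVlt; apply/orP; left; apply/eqP; apply: eq_bigl => S.
        by rewrite subsetT andbC.
      have := sum_subset_expr (rate * v) [set: T].
      rewrite (bigD1 set0) ?sub0set //= cards0 expr0 => e.
      have : (1 + rate * v) ^+ #|[set: T]| <= 4 / 3.
        by apply: (@one_add_expr_le _ _ #|T|); rewrite ?cardsT.
      rewrite -e; lra.
    have : 0 <= #|X|%:R :> R by [].
    move: hs; set q := \sum_(S | _) _; nra.
  have := subset_leq_card sW; rewrite -(ler_nat R) => c1.
  have := cardsID X' X; rewrite (setIidPr _) => [<-|]; last first.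
    by apply/subsetP => x; rewrite inE => /andP[].
  rewrite natrD.
  move: cW2; have -> : #|X|%:R = #|X'|%:R + #|X :\: X'|%:R :> R.
    rewrite -natrD -(cardsID X' X) (setIidPr _) //.
    by apply/subsetP => x; rewrite inE => /andP[].
  lra.
- by move=> x; rewrite inE => /andP[_]; apply: unbiased_safe.
Qed.

End Safety.

(** * Simulation of protocols by decision trees *)

Section Simulation.
Variables (R : realType) (l : nat) (L : finType) (O : Type).
Variable F : search_problem {ffun 'I_l -> bool} O.
Notation word := {ffun 'I_l -> L}.
Implicit Types (X Y : {set word}) (I J K : {set 'I_l}) (b x y : word).
Implicit Types (g : L -> L -> bool) (z : {ffun 'I_l -> bool}).
Local Notation n := (#|L|%:R : R).

Variables (m : nat) (lam B gam v M rho : R).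
Hypotheses (n0 : (0 < #|L|)%N) (l0 : (0 < l)%N) (m0 : (0 < m)%N).
Hypotheses (lam0 : 0 < lam) (gam0 : 0 <= gam) (v1 : 1 <= v).
Hypothesis hB : (8 * l%:R) ^+ m <= B.
Hypothesis hrate :
  4 * l%:R * (64 * l%:R ^+ 2 * (B * lam) * lam * n ^+ 2 * gam * v) <= 1.
Hypothesis hv : 4 * l%:R * n <= v ^+ m.
(** [M] is the rate of the initial sets. Fixing a coordinate gains [lam / M] in density, which by
    [hM] covers the losses of a round, at most 8 per coordinate, and leaves [rho] to pay for the
    query. *)
Hypotheses (M0 : 0 < M) (rho1 : 1 <= rho) (hM : rho * M * 8 <= lam).

(** [beta] is a depth budget in multiplicative form, so that it can be compared with densities; [z0]
    records the answers known outside [I]. *)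
Definition solvable I z0 (beta : R) :=
  exists t : dtree l O, rho ^+ ddepth t <= beta /\
    forall z, {in ~: I, forall i, z i = z0 i} -> F z (deval t z).

Lemma solvable_le I z0 beta beta' :
  beta <= beta' -> solvable I z0 beta -> solvable I z0 beta'.
Proof. by move=> le [t [dt ht]]; exists t; split=> //; apply: le_trans le. Qed.

Lemma solvable_query1 I z0 beta i : i \in I ->
  (forall z, {in ~: I, forall j, z j = z0 j} -> solvable (I :\ i) z beta) ->
  solvable I z0 (rho * beta).
Proof.
move=> iI h.
pose zc (c : bool) : {ffun 'I_l -> bool} := [ffun j => if j == i then c else z0 j].
have hz c : {in ~: I, forall j, zc c j = z0 j}.
  by move=> j; rewrite inE ffunE; case: eqVneq => // ->; rewrite iI.
have [t0 [d0 h0]] := h _ (hz false); have [t1 [d1 h1]] := h _ (hz true).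
exists (DQuery i t0 t1); split=> [|z hz0] /=.
  rewrite exprS ler_wpM2l ?(le_trans ler01 rho1) //.
  by case: (leqP (ddepth t0)).
case: ifP => zi; [apply: h1|apply: h0] => j; rewrite !inE ffunE;
  by case: eqVneq => [-> //|_] /=; move=> jI; apply: hz0; rewrite inE.
Qed.

Lemma solvable_query I K z0 beta : K \subset I ->
  (forall z, {in ~: I, forall i, z i = z0 i} -> solvable (I :\: K) z beta) ->
  solvable I z0 (rho ^+ #|K| * beta).
Proof.
elim: {K}#|K| {-2}K (erefl #|K|) I z0 => [|k IH] K cK I z0 sK h.
  rewrite cK mul1r; move/eqP: cK h; rewrite cards_eq0 => /eqP-> h.
  by have := h z0 (fun _ _ => erefl); rewrite setD0.
have /card_gt0P[i iK] : (0 < #|K|)%N by rewrite cK.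
have cK1 : #|K :\ i| = k by move: cK; rewrite (cardsD1 i) iK => -[].
have iI := subsetP sK i iK.
rewrite cK exprS -mulrA; apply: (solvable_query1 iI) => z hz.
rewrite -cK1; apply: IH => // [|z' hz'].
  by apply: setSD.
have -> : (I :\ i) :\: (K :\ i) = I :\: K.
  apply/setP => j; rewrite !inE; case: eqVneq => [->|_] /=; by rewrite ?iK ?andbF.
apply: h => j jI; rewrite hz' ?hz //; move: jI; rewrite !inE => jI.
by rewrite (negPf jI) andbF.
Qed.

(* [cX] caps the fibres of [X] at the rate [M]; it survives shrinking [X], so
   [cX / #|X|] measures how much of [X] has been lost beyond that rate. *)
Record live g (Q : {set word} -> {set word} -> Prop) I z0 X Y
    (muX muY cX cY : R) : Prop := Live {
  live_X : X != set0;
  live_Y : Y != set0;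
  live_solved : Q X Y;
  live_fixed : {in X & Y, forall x y, {in ~: I, forall i, g (x i) (y i) = z0 i}};
  live_spreadX : spread X I muX #|X|%:R;
  live_spreadY : spread Y I muY #|Y|%:R;
  live_capX : spread X I M cX;
  live_capY : spread Y I M cY }.

(** Source of the density gain: the cap drops by [M ^+ #|K|], whereas a heavy fiber keeps more than
    [lam ^+ #|K|] of its set. *)
Lemma spread_fiber X K I b cX : K \subset I ->
  spread X I M cX -> spread (fiber X K b) (I :\: K) M (M ^+ #|K| * cX).
Proof.
move=> sK h K' b'; rewrite subsetD => /andP[sK' dK].
rewrite fiber_fiber 1?disjoint_sym // mulrA -exprD.
have -> : (#|K'| + #|K|)%N = #|K :|: K'|.
  by apply/esym/eqP; rewrite addnC (leq_card_setU K K') disjoint_sym.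
by apply: h; rewrite subUset sK.
Qed.

Lemma spreadI X I I' mu c : I' \subset I -> spread X I mu c ->
  spread (R := R) X I' mu c.
Proof. by move=> sI h K b sK; apply: h; apply: subset_trans sI. Qed.

Lemma live_flip g Q I z0 X Y muX muY cX cY :
  live g Q I z0 X Y muX muY cX cY ->
  live (flip g) (flip Q) I z0 Y X muY muX cY cX.
Proof.
by case=> ? ? ? h *; split=> // y x yY xX i iI; apply: h.
Qed.

Lemma safe_half g X Y I : box R g <= (gam * n ^+ 2) ^+ 2 ->
  spread X I (B * lam) #|X|%:R -> spread Y I lam #|Y|%:R ->
  exists X', [/\ X' \subset X, #|X|%:R <= 2 * #|X'|%:R :> R &
    forall x, x \in X' -> safe lam B g Y I x].
Proof.
have := @exists_safe_half R 'I_l L m lam B gam v n0; rewrite !card_ord.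
by move=> /(_ l0 m0 lam0 gam0 v1 hB hrate hv g X Y I).
Qed.

(* The sides alternate: fixing the heavy part of [X] makes [X] strongly spread
   and leaves [Y] weakly spread on fewer coordinates. *)
Lemma restore_spread g Q a I z0 X Y cX cY :
  box R g <= (gam * n ^+ 2) ^+ 2 -> 0 <= a ->
  (forall X Y X' Y', X' \subset X -> Y' \subset Y -> Q X Y -> Q X' Y') ->
  (forall I z0 X Y cX cY, live g Q I z0 X Y lam lam cX cY ->
     solvable I z0 (a * (cX * cY / (#|X|%:R * #|Y|%:R)))) ->
  live g Q I z0 X Y (B * lam) lam cX cY ->
  solvable I z0 (2 * a * (cX * cY / (#|X|%:R * #|Y|%:R))).
Proof.
(* The induction on [#|I|] generalizes [g] and [Q] because the two players swap roles in each
   round. *)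
move=> hbox a0; elim: {I}#|I|.+1 {-2}I (ltnSn #|I|) g Q hbox z0 X Y cX cY => // N IH I.
rewrite ltnS => cI g Q hbox z0 X Y cX cY monQ hstrong [nX nY qXY fXY spX spY capX capY].
have [x0 xX0] := set0Pn _ nX; have [y0 yY0] := set0Pn _ nY.
have pX : 0 < #|X|%:R :> R by rewrite ltr0n card_gt0.
have pY : 0 < #|Y|%:R :> R by rewrite ltr0n card_gt0.
have cX0 : 0 < cX by apply: lt_le_trans (spread_card x0 capX).
have cY0 : 0 < cY by apply: lt_le_trans (spread_card y0 capY).
have [X' [sX' cX' safeX']] := safe_half hbox spX spY.
have pX' : 0 < #|X'|%:R :> R by lra.
have nX' : X' != set0 by rewrite -card_gt0 -(ltr0n R).
have capX' : spread X' I M cX by apply: spread_sub capX.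
case: (pselect (spread X' I lam #|X'|%:R)) => [spX'|nspX'].
  apply: solvable_le (hstrong I z0 X' Y cX cY _); last first.
    split=> //; first exact: monQ qXY.
    by move=> x y xX yY; apply: fXY => //; apply: (subsetP sX').
  rewrite (mulrC 2 a) -!mulrA ler_wpM2l // [leRHS]mulrCA.
  rewrite ler_wpM2l ?(ltW cX0) // [leRHS]mulrCA ler_wpM2l ?(ltW cY0) //.
  rewrite !invfM mulrA ler_wpM2r ?invr_ge0 ?(ltW pY) //.
  by rewrite ler_pdivlMr // mulrC ler_pdivrMr // mulrC.
have [K [b [sK nK heavy spX'']]] := maximal_heavy_fiber (ltW lam0) nspX'.
set X'' := fiber X' K b in heavy spX''.
have k0 : (0 < #|K|)%N by rewrite card_gt0.
have pX'' : 0 < #|X''|%:R :> R.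
  by apply: le_lt_trans heavy; rewrite mulr_ge0 ?exprn_ge0 ?(ltW lam0) // ltW.
have nX'' : X'' != set0 by rewrite -card_gt0 -(ltr0n R).
have [x1 xX1] := set0Pn _ nX''.
have xX1' : x1 \in X' by move: xX1; rewrite inE => /andP[].
have agr x : x \in X'' -> {in K, forall i, x i = b i}.
  by rewrite inE => /andP[_ /agreeP].
(* The budget left after fixing [K]: the cap of [X] has dropped by [M ^+ #|K|], and the denominator
   holds the lower bounds for [Y''] (from safety) and for [X''] (from heaviness). *)
pose beta := 2 * a * (cY * (M ^+ #|K| * cX) /
   (#|Y|%:R / 2 ^+ #|K|.+1 * (lam ^+ #|K| * (#|X|%:R / 2)))).
suff h : solvable I z0 (rho ^+ #|K| * beta).
  apply: solvable_le h; rewrite /beta.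
  have rM0 : 0 <= rho * M by rewrite mulr_ge0 ?(ltW M0) // (le_trans ler01).
  have lk0 : lam ^+ #|K| != 0 by rewrite lt0r_neq0 // exprn_gt0.
  have tk0 : 2 ^+ #|K| != 0 :> R by rewrite lt0r_neq0 // exprn_gt0.
  have -> : rho ^+ #|K| * (2 * a * (cY * (M ^+ #|K| * cX) /
     (#|Y|%:R / 2 ^+ #|K|.+1 * (lam ^+ #|K| * (#|X|%:R / 2))))) =
     2 * a * (cX * cY / (#|X|%:R * #|Y|%:R)) *
     (4 * 2 ^+ #|K| * (rho ^+ #|K| * M ^+ #|K|) / lam ^+ #|K|).
    rewrite exprS.
    by field; rewrite lk0 !gt_eqF ?exprn_gt0.
  rewrite ler_piMr //.
    by rewrite !mulr_ge0 ?invr_ge0 ?mulr_ge0 // ltW.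
  rewrite ler_pdivrMr ?exprn_gt0 // mul1r -exprMn.
  (* The loss [4 * 2 ^+ #|K|] comes from halving [X] and from the share of [Y] kept; it is at most
     [8 ^+ #|K|] since [K] is nonempty. *)
  apply: (@le_trans _ _ (4 ^+ #|K| * 2 ^+ #|K| * (rho * M) ^+ #|K|)).
    rewrite ler_wpM2r ?exprn_ge0 //.
    by rewrite ler_wpM2r ?exprn_ge0 // -[leLHS]expr1 ler_weXn2l //; lra.
  have rM8 : 0 <= 4 * 2 * (rho * M) by rewrite mulr_ge0 // mulr_ge0.
  rewrite -!exprMn lerXn2r ?nnegrE ?(ltW lam0) //.
  by apply: le_trans hM; rewrite le_eqVlt; apply/orP; left; apply/eqP; ring.
apply: solvable_query => // z hz.
(* All words of [X''] agree with [x1] on [K], so conditioning [Y] on outputs [z] against the one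
   word [x1] fixes the outputs on [K] for all of [X'']. *)
have [hY'' spY''] := safeX' x1 xX1' K z sK.
set Y'' := cond g Y K x1 z in hY'' spY''.
have pY'' : 0 < #|Y''|%:R :> R.
  rewrite ltNge; apply/negP => h.
  suff : 2 ^+ #|K|.+1 * #|Y''|%:R <= 0 :> R by lra.
  by rewrite mulr_ge0_le0 ?exprn_ge0.
have nY'' : Y'' != set0 by rewrite -card_gt0 -(ltr0n R).
have sX'' : X'' \subset X by apply: subset_trans sX'; apply: fiber_sub.
have sY'' : Y'' \subset Y by apply: cond_sub.
(* By safety [Y''] is weakly spread, by maximality of the block [X''] is strongly spread: the
   starting situation with the players exchanged. *)
have lv : live (flip g) (flip Q) (I :\: K) z Y'' X'' (B * lam) lam cY (M ^+ #|K| * cX).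
  split=> //.
  - exact: monQ qXY.
  - move=> y x yY xX i; rewrite !inE negb_and negbK /flip.
    have [iK _|_ /= iI] := boolP (i \in K).
      rewrite (agr x) // -(agr x1) //.
      by move: yY; rewrite inE => /andP[_ /forall_inP/(_ i iK)/eqP].
    by rewrite (fXY x y) ?inE // ?hz ?inE // ?(subsetP sX'') ?(subsetP sY'').
  - apply: (spreadI (subsetDl I K)); exact: spread_sub capY.
  - exact: spread_fiber.
apply: solvable_le (IH _ _ (flip g) (flip Q) _ z Y'' X'' _ _ _ _ lv).
- have c0 : 0 <= cY * (M ^+ #|K| * cX) by rewrite ltW // !mulr_gt0 ?exprn_gt0.
  rewrite /beta ler_wpM2l ?mulr_ge0 // ler_wpM2l //.
  rewrite lef_pV2 ?posrE; last 2 first.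
  - by rewrite mulr_gt0.
  - by rewrite !(mulr_gt0, invr_gt0, exprn_gt0).
  have lk0 : 0 <= lam ^+ #|K| by rewrite exprn_ge0 // ltW.
  apply: ler_pM; rewrite ?divr_ge0 ?exprn_ge0 //; first by rewrite mulr_ge0 // divr_ge0.
    by rewrite ler_pdivrMr ?exprn_gt0 // mulrC.
  by apply: le_trans (ltW heavy); rewrite ler_wpM2l // ler_pdivrMr // mulrC.
- apply: leq_trans cI; rewrite cardsD (setIidPr sK).
  by rewrite ltn_subrL k0 (leq_trans k0) // subset_leq_card.
- by rewrite box_flip.
- by move=> X1 Y1 X2 Y2 s1 s2; apply: monQ.
- move=> J z1 X1 Y1 cX1 cY1 /live_flip lv1.
  have := hstrong _ _ _ _ _ _ lv1; by rewrite (mulrC cY1) (mulrC #|Y1|%:R).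
Qed.

(** Halving the set at most doubles the relative size of a fiber, and [B ^+ #|K|] absorbs this
    factor for nonempty [K]. *)
Lemma spread_half X X' I : X' \subset X -> #|X|%:R <= 2 * #|X'|%:R :> R ->
  spread X I lam #|X|%:R -> spread X' I (B * lam) #|X'|%:R.
Proof.
move=> sW cW spW K b sK; have [->|nK] := eqVneq K set0.
  by rewrite fiber0 cards0 mul1r.
have B2 : 2 <= B.
  apply: le_trans hB; apply: (@le_trans _ _ (8 * l%:R)).
    have : 1 <= l%:R :> R by rewrite ler1n.
    lra.
  have l1 : 1 <= l%:R :> R by rewrite ler1n.
  by rewrite -[leLHS]expr1 ler_weXn2l //; lra.
have lk0 : 0 <= lam ^+ #|K| by rewrite exprn_ge0 // ltW.
apply: (@le_trans _ _ (lam ^+ #|K| * (2 * #|X'|%:R))).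
  apply: le_trans (ler_wpM2l lk0 cW); apply: le_trans (spW K b sK).
  by rewrite ler_nat subset_leq_card // fiberS.
rewrite exprMn mulrA ler_wpM2r // mulrC ler_wpM2r //.
apply: (le_trans B2); rewrite -[leLHS]expr1 ler_weXn2l ?card_gt0 //; lra.
Qed.

(** The cost of one message: a factor 2 for keeping the more frequent answer and a factor 2 for
    restoring strong spreadness. *)
Lemma solvable_half g (Q Q' : {set word} -> {set word} -> Prop) a
    I z0 X X' Y cX cY :
  box R g <= (gam * n ^+ 2) ^+ 2 -> 0 <= a ->
  (forall X Y X' Y', X' \subset X -> Y' \subset Y -> Q' X Y -> Q' X' Y') ->
  (forall I z0 X Y cX cY, live g Q' I z0 X Y lam lam cX cY ->
     solvable I z0 (a * (cX * cY / (#|X|%:R * #|Y|%:R)))) ->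
  live g Q I z0 X Y lam lam cX cY ->
  X' \subset X -> #|X|%:R <= 2 * #|X'|%:R :> R -> Q' X' Y ->
  solvable I z0 (4 * a * (cX * cY / (#|X|%:R * #|Y|%:R))).
Proof.
move=> hbox a0 monQ hstrong [nX nY _ fXY spX spY capX capY] sX' cX' qX'.
have [x0 xX0] := set0Pn _ nX; have [y0 yY0] := set0Pn _ nY.
have pX : 0 < #|X|%:R :> R by rewrite ltr0n card_gt0.
have pY : 0 < #|Y|%:R :> R by rewrite ltr0n card_gt0.
have cX0 : 0 < cX by apply: lt_le_trans (spread_card x0 capX).
have cY0 : 0 < cY by apply: lt_le_trans (spread_card y0 capY).
have pX' : 0 < #|X'|%:R :> R by lra.
have lv : live g Q' I z0 X' Y (B * lam) lam cX cY.
  split=> //; first by rewrite -card_gt0 -(ltr0n R).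
  - by move=> x y xX yY; apply: fXY => //; apply: (subsetP sX').
  - exact: spread_half spX.
  - exact: spread_sub capX.
apply: solvable_le (restore_spread hbox a0 monQ hstrong lv).
have -> : 4 * a * (cX * cY / (#|X|%:R * #|Y|%:R)) =
    2 * a * (cX * cY / (#|X|%:R / 2 * #|Y|%:R)).
  by field; rewrite !gt_eqF.
rewrite ler_wpM2l ?mulr_ge0 // ler_wpM2l ?mulr_ge0 ?(ltW cX0) ?(ltW cY0) //.
rewrite lef_pV2 ?posrE ?mulr_gt0 ?invr_gt0 //.
by rewrite ler_wpM2r ?(ltW pY) // ler_pdivrMr // mulrC.
Qed.

Lemma solvable_fully_spread g (Q : {set word} -> {set word} -> Prop) o
    I z0 X Y cX cY :
  box R g <= (gam * n ^+ 2) ^+ 2 ->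
  (forall x y, Q X Y -> x \in X -> y \in Y -> F (gadget_eval g x y) o) ->
  live g Q I z0 X Y lam lam cX cY ->
  solvable I z0 (cX * cY / (#|X|%:R * #|Y|%:R)).
Proof.
move=> hbox hQ [nX nY qXY fXY spX spY capX capY].
have [x0 xX0] := set0Pn _ nX; have [y0 yY0] := set0Pn _ nY.
have pX : 0 < #|X|%:R :> R by rewrite ltr0n card_gt0.
have pY : 0 < #|Y|%:R :> R by rewrite ltr0n card_gt0.
exists (DLeaf _ o); split=> [|z hz].
  rewrite expr0 ler_pdivlMr ?mulr_gt0 // mul1r.
  by apply: ler_pM; rewrite ?ler0n //; [apply: spread_card x0 capX|apply: spread_card y0 capY].
have spX1 : spread X I (B * lam) #|X|%:R by apply: spread_half spX => //; lra.
have [X' [sX' cX' safeX']] := safe_half hbox spX1 spY.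
have : 0 < #|X'|%:R :> R by lra.
rewrite ltr0n => /card_gt0P[x xX'].
have [hc _] := safeX' x xX' I z (subxx _).
have : 0 < #|cond g Y I x z|%:R :> R.
  rewrite ltNge; apply/negP => h.
  suff : 2 ^+ #|I|.+1 * #|cond g Y I x z|%:R <= 0 :> R by lra.
  by rewrite mulr_ge0_le0 ?exprn_ge0.
rewrite ltr0n => /card_gt0P[y]; rewrite inE => /andP[yY /forall_inP hy].
have -> : z = gadget_eval g x y.
  apply/ffunP => i; rewrite ffunE; have [iI|iI] := boolP (i \in I).
    by rewrite (eqP (hy i iI)).
  have xX : x \in X by apply: (subsetP sX').
  by rewrite (fXY x y xX yY i) ?inE // hz // inE.
by apply: hQ => //; apply: (subsetP sX').
Qed.

Lemma exists_half (T : finType) (X : {set T}) (a : T -> bool) :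
  exists c, #|X|%:R <= 2 * #|[set x in X | a x == c]|%:R :> R.
Proof.
have e : #|X| = (#|[set x in X | a x == true]| + #|[set x in X | a x == false]|)%N.
  rewrite -(cardsID [set x | a x] X); congr (_ + _)%N; apply: eq_card => x;
  by rewrite !inE; case: (x \in X); case: (a x).
have [le|lt] := leqP #|[set x in X | a x == false]| #|[set x in X | a x == true]|.
  by exists true; rewrite -natrM ler_nat e mul2n -addnn leq_add2l.
by exists false; rewrite -natrM ler_nat e mul2n -addnn leq_add2r ltnW.
Qed.

(** Induction on the protocol with a factor 4 per message; [grow] pads a shallower subprotocol, and
    messages of Bob are handled by exchanging the players. *)
Lemma solvable_protocol g (P : protocol word word O) I z0 X Y cX cY :
  box R g <= (gam * n ^+ 2) ^+ 2 ->
  live g (fun X Y => protocol_solves (compose F g) X Y P) I z0 X Y lam lam cX cY ->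
  solvable I z0 (4 ^+ pdepth P * (cX * cY / (#|X|%:R * #|Y|%:R))).
Proof.
move=> hbox; pose Q P X Y := protocol_solves (compose F g) X Y P.
have monQ P' X1 Y1 X2 Y2 : X2 \subset X1 -> Y2 \subset Y1 -> Q P' X1 Y1 -> Q P' X2 Y2.
  by move=> /subsetP sX /subsetP sY h x y xX yY; apply: h; [apply: sX|apply: sY].
have grow (d d' : nat) I1 z1 c : (d <= d')%N -> 0 <= c ->
    solvable I1 z1 (4 * 4 ^+ d * c) -> solvable I1 z1 (4 ^+ d'.+1 * c).
  move=> dd' c0; apply: solvable_le; rewrite exprS ler_wpM2r // ler_wpM2l //.
  by rewrite ler_weXn2l //; lra.
elim: P I z0 X Y cX cY => [o|a P0 IH0 P1 IH1|a P0 IH0 P1 IH1] I z0 X Y cX cY lv.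
- rewrite mul1r; apply: solvable_fully_spread hbox _ lv => x y h; exact: h.
- have c0 : 0 <= cX * cY / (#|X|%:R * #|Y|%:R).
    case: lv => /set0Pn[x0 _] /set0Pn[y0 _] _ _ _ _ capX capY.
    rewrite !mulr_ge0 ?invr_ge0 ?mulr_ge0 //.
      exact: le_trans (spread_card x0 capX).
    exact: le_trans (spread_card y0 capY).
  have [c hc] := exists_half X a.
  have sub : [set x in X | a x == c] \subset X.
    by apply/subsetP => x; rewrite inE => /andP[].
  have IH c' : forall I z0 X Y cX cY,
     live g (Q (if c' then P1 else P0)) I z0 X Y lam lam cX cY ->
     solvable I z0 (4 ^+ pdepth (if c' then P1 else P0) *
       (cX * cY / (#|X|%:R * #|Y|%:R))).
    by case: c'.
  apply: (grow (pdepth (if c then P1 else P0))) => //.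
    by case: (c); rewrite ?leq_maxl ?leq_maxr.
  apply: (solvable_half hbox _ (@monQ (if c then P1 else P0)) (IH c) lv sub hc).
    by rewrite exprn_ge0.
  move=> x y; rewrite inE => /andP[xX /eqP axc] yY.
  by have := live_solved lv _ _ xX yY; rewrite /= axc; case: (c).
- have c0 : 0 <= cX * cY / (#|X|%:R * #|Y|%:R).
    case: lv => /set0Pn[x0 _] /set0Pn[y0 _] _ _ _ _ capX capY.
    rewrite !mulr_ge0 ?invr_ge0 ?mulr_ge0 //.
      exact: le_trans (spread_card x0 capX).
    exact: le_trans (spread_card y0 capY).
  have [c hc] := exists_half Y a.
  have sub : [set y in Y | a y == c] \subset Y.
    by apply/subsetP => y; rewrite inE => /andP[].
  have IH c' : forall I z0 Y X cY cX,
     live (flip g) (flip (Q (if c' then P1 else P0))) I z0 Y X lam lam cY cX ->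
     solvable I z0 (4 ^+ pdepth (if c' then P1 else P0) *
       (cY * cX / (#|Y|%:R * #|X|%:R))).
    move=> I1 z1 Y1 X1 cY1 cX1 /live_flip lv1.
    by rewrite (mulrC cY1) (mulrC #|Y1|%:R); case: c' lv1; [apply: IH1|apply: IH0].
  apply: (grow (pdepth (if c then P1 else P0))) => //.
    by case: (c); rewrite ?leq_maxl ?leq_maxr.
  rewrite (mulrC cX) (mulrC #|X|%:R).
  have hbox' : box R (flip g) <= (gam * n ^+ 2) ^+ 2 by rewrite box_flip.
  apply: (solvable_half hbox' _ _ (IH c) (live_flip lv) sub hc).
  + by rewrite exprn_ge0.
  + by move=> X1 Y1 X2 Y2 s1 s2; apply: monQ.
  move=> x y xX; rewrite inE => /andP[yY /eqP ayc].
  by have := live_solved lv _ _ xX yY; rewrite /= ayc; case: (c).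
Qed.

End Simulation.

(** * Discrepancy, average degree and the choice of parameters *)

Section Gadget.
Variables (R : realType) (L : finType) (g : L -> L -> bool).
Local Notation n := (#|L|%:R : R).

Lemma norm_sum_rect_le_disc (A B : {set L}) : (0 < #|L|)%N ->
  `|\sum_(u in A) \sum_(v in B) sgn R g u v| <= disc R g * n ^+ 2.
Proof.
move=> n0; have n2 : 0 < n ^+ 2 by rewrite exprn_gt0 // ltr0n.
have : disc_rect R g A B <= disc R g.
  exact: (le_bigmax _
    (fun AB : {set L} * {set L} => disc_rect R g AB.1 AB.2) (A, B)).
rewrite -(ler_pM2r n2); apply: le_trans.
rewrite /disc_rect /unif_prob -mulrBl normrM card_prod natrM -expr2.
rewrite [`|_^-1|]gtr0_norm ?invr_gt0 // divfK ?gt_eqF //.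
rewrite pair_big /= le_eqVlt; apply/orP; left; apply/eqP; congr `|_|.
rewrite -!sum1_card !natr_sum.
rewrite big_mkcond [X in _ = X - _]big_mkcond [X in _ = _ - X]big_mkcond /=.
rewrite -sumrB; apply: eq_bigr => -[u v] _; rewrite !inE /sgn /=.
by case: (u \in A); case: (v \in B); case: (g u v); rewrite /= ?subr0 ?sub0r.
Qed.

Lemma sum_sign (q : pred L) (f : L -> R) :
  \sum_v f v * (-1) ^+ q v =
  \sum_(v in [set v | ~~ q v]) f v - \sum_(v in [set v | q v]) f v.
Proof.
rewrite [X in _ = X - _]big_mkcond [X in _ = _ - X]big_mkcond /= -sumrB; apply: eq_bigr => v _.
by rewrite !inE; case: (q v); rewrite ?mulrN1 ?mulr1 ?sub0r ?subr0.
Qed.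

(** Each sign vector splits [L] in two, so the sum breaks into four rectangles. *)
Lemma norm_sum_sign_le_disc (p q : pred L) : (0 < #|L|)%N ->
  `|\sum_u \sum_v sgn R g u v * (-1) ^+ p u * (-1) ^+ q v|
  <= 4 * (disc R g * n ^+ 2).
Proof.
move=> n0.
have -> : \sum_u \sum_v sgn R g u v * (-1) ^+ p u * (-1) ^+ q v =
    \sum_u (\sum_v sgn R g u v * (-1) ^+ q v) * (-1) ^+ p u.
  apply: eq_bigr => u _; rewrite mulr_suml; apply: eq_bigr => v _.
  by rewrite mulrAC.
rewrite sum_sign.
rewrite !(eq_bigr _ (fun u _ => sum_sign q (sgn R g u))) !big_split /= !sumrN.
have h A B := norm_sum_rect_le_disc A B n0.
apply: le_trans (ler_normB _ _) _.
apply: le_trans (lerD (ler_normB _ _) (ler_normB _ _)) _.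
apply: le_trans (lerD (lerD (h _ _) (h _ _)) (lerD (h _ _) (h _ _))) _.
by rewrite le_eqVlt; apply/orP; left; apply/eqP; ring.
Qed.

(* For fixed [u', v'] the remaining double sum tests the gadget against the sign
   vectors [g _ v'] and [g u' _]. *)
Lemma box_le_disc : (0 < #|L|)%N -> box R g <= 4 * disc R g * n ^+ 4.
Proof.
move=> n0; rewrite /box exchange_big /=.
have e v' : \sum_v (\sum_u sgn R g u v * sgn R g u v') ^+ 2 =
    \sum_u' sgn R g u' v' *
      (\sum_u \sum_v sgn R g u v * (-1) ^+ g u v' * (-1) ^+ g u' v).
  rewrite (eq_bigr (fun v => \sum_u' \sum_u sgn R g u' v' *
      (sgn R g u v * (-1) ^+ g u v' * (-1) ^+ g u' v))) => [|v _].
    rewrite exchange_big; apply: eq_bigr => u' _.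
    by rewrite exchange_big mulr_sumr; apply: eq_bigr => u _; rewrite mulr_sumr.
  rewrite expr2 mulr_suml exchange_big; apply: eq_bigr => u _ /=.
  by rewrite mulr_sumr; apply: eq_bigr => u' _; rewrite /sgn; ring.
apply: (@le_trans _ _ (\sum_(v' : L) \sum_(u' : L) 4 * (disc R g * n ^+ 2))).
  apply: ler_sum => v' _; rewrite e; apply: ler_sum => u' _.
  apply: le_trans (ler_norm _) _.
  rewrite normrM normrX normrN1 expr1n mul1r.
  exact: (norm_sum_sign_le_disc (fun u => g u v') (fun v => g u' v)).
by rewrite !sumr_const -mulrnA -[leLHS]mulr_natr natrM -!mulrA -expr2.
Qed.

End Gadget.

(** * From average degree to spreadness *)

Section Projections.
Variables (R : realType) (L : finType) (l : nat).
Notation word := {ffun 'I_l -> L}.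
Implicit Types (W : {set word}) (K : {set 'I_l}).

Lemma sum_degree W K :
  (\sum_(w' in proj (~: K) W) degree W w')%N = #|W|.
Proof.
rewrite -sum1_card (partition_big (restrict (~: K)) (mem (proj (~: K) W))).
  apply: eq_bigr => w' _; rewrite /degree -sum1_card; apply: eq_bigl => w.
  by rewrite inE.
by move=> w wW; apply: imset_f.
Qed.

Lemma card_fiber_le_proj W K b : (#|fiber W K b| <= #|proj (~: K) W|)%N.
Proof.
rewrite -(@card_in_imset _ _ (restrict (~: K))) => [|w w'].
  by apply: subset_leq_card; apply: imsetS; apply: fiber_sub.
rewrite !inE => /andP[_ /agreeP h] /andP[_ /agreeP h'] /ffunP e.
apply/ffunP => i; have [iK|iK] := boolP (i \in K); first by rewrite h // h'.
have iC : i \in ~: K by rewrite inE.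
by have := e (exist _ i iC); rewrite !ffunE.
Qed.

(** The average degree is [#|W|] divided by the size of the projection. A lower bound on it thus
    caps the projection, into which every fiber over [K] injects. *)
Lemma ravg_deg_spread W (D : R) : (0 < #|L|)%N -> 0 < D ->
  (forall K, 1 / D ^+ #|K| <= ravg_deg R K W) ->
  spread W [set: 'I_l] (D / #|L|%:R) #|W|%:R.
Proof.
move=> n0 D0 h K b _; have n1 : 0 < #|L|%:R :> R by rewrite ltr0n.
have := h K; rewrite /ravg_deg /avg_deg -natr_sum sum_degree.
have := card_fiber_le_proj W K b; rewrite -(ler_nat R).
set q := #|proj _ _|%:R => hq; have [q0|q0] := leP q 0.
  by move=> _; apply: le_trans hq (le_trans q0 _);
    rewrite mulr_ge0 ?exprn_ge0 ?divr_ge0 // ltW.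
rewrite ler_pdivlMr ?exprn_gt0 // ler_pdivlMr // => h1.
apply: le_trans hq _; rewrite expr_div_n.
have Dk : 0 < D ^+ #|K| by rewrite exprn_gt0.
rewrite mulrAC ler_pdivlMr ?exprn_gt0 // -ler_pdivrMl //.
by apply: le_trans h1; rewrite mul1r mulrA mulrAC.
Qed.

(** For empty [W] the average is 0 / 0 = 0, so the degree bound at the empty block already forces
    nonemptiness. *)
Lemma ravg_deg_neq0 W : 1 <= ravg_deg R set0 W -> W != set0.
Proof.
apply: contraTneq => ->; rewrite /ravg_deg /avg_deg big1 ?mul0r ?ler10 //.
by move=> w' /imsetP[w]; rewrite inE.
Qed.

End Projections.

Lemma leastP (P : nat -> Prop) (exP : exists k, P k) : P (least exP).
Proof. by rewrite /least; case: ex_minnP => k /asboolP. Qed.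

Lemma least_le (P : nat -> Prop) (exP : exists k, P k) k :
  P k -> (least exP <= k)%N.
Proof. by move=> Pk; rewrite /least; case: ex_minnP => j _; apply; apply/asboolP. Qed.

(** * Real powers of 2, logarithms, and the parameters *)

Section Exponentials.
Variable R : realType.
Local Notation E x := (2 `^ x : R).

Lemma pow2_gt0 (x : R) : 0 < E x. Proof. by rewrite powR_gt0. Qed.

Lemma pow2D (x y : R) : E (x + y) = E x * E y.
Proof. by rewrite powRD // pnatr_eq0 implybT. Qed.

Lemma pow2X (x : R) k : E x ^+ k = E (x * k%:R).
Proof. by rewrite powRrM powR_mulrn // ltW // pow2_gt0. Qed.

Lemma pow2_nat k : E k%:R = 2 ^+ k.
Proof. by rewrite powR_mulrn. Qed.

Lemma ler_pow2 (x y : R) : (E x <= E y) = (x <= y).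
Proof.
rewrite -ler_ln ?posrE ?pow2_gt0 // !ln_powR ler_pM2r //.
by rewrite ln_gt0 // ltr1n.
Qed.

Lemma pow2_log2 (x : R) : 0 < x -> E (log2 x) = x.
Proof.
move=> x0; apply: ln_inj; rewrite ?posrE ?pow2_gt0 //.
by rewrite ln_powR /log2 divfK // gt_eqF // ln_gt0 // ltr1n.
Qed.

Lemma log2_ge1 (x : R) : 2 <= x -> 1 <= log2 x.
Proof.
move=> x2; rewrite -ler_pow2 pow2_log2; last exact: lt_le_trans x2.
by rewrite powRr1.
Qed.

End Exponentials.

Lemma lifting_parameters (R : realType) (eta : R) (d : nat) : 0 < eta ->
  exists (c m : nat), (0 < m)%N /\
  forall l t : nat, (2 <= l)%N -> c%:R * log2 l%:R <= t%:R :> R ->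
  exists lam gam v rho : R, let n := 2 `^ t%:R in
  [/\ 0 < lam, 0 <= gam & 1 <= v] /\
  [/\ 4 * l%:R * (64 * l%:R ^+ 2 * ((8 * l%:R) ^+ m * lam) * lam * n ^+ 2 * gam * v) <= 1,
     4 * l%:R * n <= v ^+ m,
     gam ^+ 2 = 4 * 2 `^ (- (eta * t%:R)),
     rho * (d%:R * l%:R ^+ d / n) * 8 <= lam &
     2 `^ (eta * t%:R / 32) <= rho].
Proof.
(* With [m = k.+1] this gives [eta * m >= 16], so that [v ^+ m] is at least the square of 2^t,
   enough for [4 * l * n]. *)
move=> eta0; have [k hk] : exists k : nat, 16 / eta < k%:R.
  by exists (Num.bound (16 / eta)); apply: archi_boundP; rewrite divr_ge0 ?(ltW eta0).
(* In the lower bound on [t], the share [a] of [c] makes the polynomial factors of the rate small,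
   and the share [b] keeps [8 * (d * l ^+ d)] below [rho]. *)
pose a : R := (12 + 4 * k.+1%:R) * (4 / eta).
pose b : R := (3 + 2 * d%:R) * (32 / eta).
have a0 : 0 <= a by rewrite /a mulr_ge0 ?divr_ge0 ?(ltW eta0) // addr_ge0 // mulr_ge0.
have b0 : 0 <= b by rewrite /b mulr_ge0 ?divr_ge0 ?(ltW eta0) // addr_ge0 // mulr_ge0.
have [c hc] : exists c : nat, 3 + a + b < c%:R.
  by exists (Num.bound (3 + a + b)); apply: archi_boundP; rewrite !addr_ge0.
exists c, k.+1; split=> // l t l2 ht; set m := k.+1 in a a0 hc *.
have hm : 16 <= eta * m%:R.
  rewrite mulrC -ler_pdivrMr //; apply: le_trans (ltW hk) _.
  by rewrite ler_nat.
move: ht; set lg := log2 _; set s : R := t%:R => ht.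
have lg1 : 1 <= lg by apply: log2_ge1; rewrite (ler_nat R 2).
have lg0 : 0 <= lg by apply: le_trans lg1.
have s0 : 0 <= s by [].
have pl : 0 < l%:R :> R by rewrite ltr0n; apply: leq_trans l2.
have El : l%:R = 2 `^ lg :> R by rewrite pow2_log2.
have hct : (3 + a + b) * lg <= s.
  by apply: le_trans ht; rewrite ler_wpM2r ?(ltW hc).
have al0 : 0 <= a * lg by rewrite mulr_ge0.
have bl0 : 0 <= b * lg by rewrite mulr_ge0.
have t3 : 3 * lg <= s by lra.
have trate : (12 + 4 * m%:R) * lg <= eta * s / 4.
  have -> : (12 + 4 * m%:R) * lg = eta * (a * lg) / 4.
    by rewrite /a; field; rewrite gt_eqF.
  by rewrite ler_wpM2r ?invr_ge0 // ler_wpM2l ?(ltW eta0) //; lra.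
have tgrow : (3 + 2 * d%:R) * lg <= eta * s / 32.
  have -> : (3 + 2 * d%:R) * lg = eta * (b * lg) / 32.
    by rewrite /b; field; rewrite gt_eqF.
  by rewrite ler_wpM2r ?invr_ge0 // ler_wpM2l ?(ltW eta0) //; lra.
have es0 : 0 <= eta * s by rewrite mulr_ge0 // ltW.
clear ht hct al0 bl0 hc a0 b0 a b hk.
have hD : 8 * (d%:R * l%:R ^+ d) <= 2 `^ (eta * s / 32).
  apply: (@le_trans _ _ (2 `^ (3%:R + d%:R + lg * d%:R))).
    rewrite (pow2D (_ + _)) (pow2D 3%:R) -pow2X -El !pow2_nat mulrA
      ler_wpM2r ?exprn_ge0 ?(ltW pl) //.
    have -> : 2 ^+ 3 = 8 :> R by ring.
    by rewrite ler_wpM2l // -natrX ler_nat ltnW // ltn_expl.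
  rewrite ler_pow2; apply: le_trans tgrow.
  have : 0 <= (3 + d%:R) * (lg - 1) by rewrite mulr_ge0 ?subr_ge0 ?addr_ge0.
  lra.
have D0 : 0 <= d%:R * l%:R ^+ d :> R by rewrite mulr_ge0 // exprn_ge0 // ltW.
have pn : 0 < 2 `^ s by exact: pow2_gt0.
(* [gam] is the square root of the bound on 4 disc. Its decay eta t/2 is spent on two factors [lam]
   (eta t/16 each) and on [v] (eta t/8); the remaining eta t/4 beats the factors in [l]. The excess
   eta t/16 of [lam] over 1/n is shared equally by [rho] and [8 * (d * l ^+ d)]. *)
exists (2 `^ (eta * s / 16) / 2 `^ s), (2 * 2 `^ (- (eta * s / 2))),
  (2 `^ (eta * s / 8)), (2 `^ (eta * s / 32)); move=> n.
split; split=> //.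
- by rewrite divr_gt0 ?pow2_gt0.
- by rewrite mulr_ge0 // ltW ?pow2_gt0.
- rewrite -[leLHS](powRr0 2) ler_pow2; lra.
- rewrite -/n; set p := 2 `^ _; set q := 2 `^ (- _); set v := 2 `^ (_ / 8).
  have -> : 4 * l%:R * (64 * l%:R ^+ 2 * ((8 * l%:R) ^+ m * (p / n)) * (p / n)
      * n ^+ 2 * (2 * q) * v) =
      2 ^+ 9 * l%:R ^+ 3 * (8 ^+ m * l%:R ^+ m) * (p ^+ 2 * q * v).
    rewrite exprMn; move: (8 ^+ m) (l%:R ^+ m) => x y.
    by field; rewrite gt_eqF.
  have -> : 8 = 2 `^ 3%:R :> R by rewrite pow2_nat; ring.
  rewrite El /p /q /v !pow2X -pow2_nat -!pow2D -[leRHS](powRr0 2) ler_pow2.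
  have : 0 <= (9 + 3 * m%:R) * (lg - 1) by rewrite mulr_ge0 ?subr_ge0 ?addr_ge0 ?mulr_ge0.
  lra.
- rewrite /n El pow2X; have -> : 4 = 2 `^ 2%:R :> R by rewrite pow2_nat; ring.
  rewrite -!pow2D ler_pow2.
  have : 0 <= (eta * m%:R - 16) * s by rewrite mulr_ge0 // subr_ge0.
  lra.
- rewrite exprMn pow2X; congr (_ * _); [by ring | congr (2 `^ _); by field].
- rewrite -/n; set e := 2 `^ (_ / 32) in hD *; set D := _ * _ ^+ d in hD D0 *.
  have -> : eta * s / 16 = eta * s / 32 + eta * s / 32 by field.
  rewrite pow2D -/e.
  have -> : e * (D / n) * 8 = e * (8 * D) / n by ring.
  by rewrite ler_wpM2r ?invr_ge0 ?(ltW pn) // ler_wpM2l // ltW ?pow2_gt0.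
Qed.

(** With [2 <= l] the logarithm is at least 1, so the bound on [t] absorbs constants too. For
    [d = 0] the degree bound on a nonempty [I] would read 1 / 0 = 0, hence [0 < d]. *)
Theorem theorem5p1 (R : realType) (eta : R) (d : nat) :
  0 < eta -> (0 < d)%N ->
  exists (c : nat) (kappa : R), 0 < kappa /\
  forall (l t : nat) (O : Type) (S : search_problem {ffun 'I_l -> bool} O)
    (gd : t.-tuple bool -> t.-tuple bool -> bool)
    (X Y : {set {ffun 'I_l -> t.-tuple bool}}),
  (2 <= l)%N ->
  disc R gd <= 2 `^ (- (eta * t%:R)) ->
  c%:R * log2 l%:R <= t%:R :> R ->
  (forall I : {set 'I_l},
     1 / (d%:R * l%:R ^+ d) ^+ #|I| <= ravg_deg R I X /\
     1 / (d%:R * l%:R ^+ d) ^+ #|I| <= ravg_deg R I Y) ->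
  kappa * (query_complexity S)%:R * t%:R <= (comm_complexity S gd X Y)%:R.
Proof.
move=> eta0 d0; have [c [m [m0 param]]] := lifting_parameters d eta0.
(* The tree bound is [rho ^+ Q <= 4 ^+ depth] with [rho] at least 2^(eta t/32); taking logarithms,
   eta t Q/32 is at most twice the depth. *)
exists c, (eta / 64); split; first by rewrite divr_gt0.
move=> l t O S gd X Y l2 hdisc ht hdeg.
have [lam [gam [v [rho [[lam0 gam0 v1] [hrate hv hgam hM hrho]]]]]] :=
  param l t l2 ht.
have cL : 2 `^ t%:R = #|{: t.-tuple bool}|%:R :> R.
  by rewrite card_tuple card_bool natrX pow2_nat.
have n0 : (0 < #|{: t.-tuple bool}|)%N by rewrite card_tuple card_bool expn_gt0.
move: hrate hv hM; rewrite cL => hrate hv hM.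
have l0 : (0 < l)%N by apply: leq_trans l2.
have D0 : 0 < d%:R * l%:R ^+ d :> R by rewrite mulr_gt0 ?exprn_gt0 ?ltr0n.
pose M : R := d%:R * l%:R ^+ d / #|{: t.-tuple bool}|%:R.
have M0 : 0 < M by rewrite divr_gt0 ?ltr0n.
have rho1 : 1 <= rho.
  apply: le_trans hrho; rewrite -[leLHS](powRr0 2) ler_pow2.
  by rewrite !mulr_ge0 ?invr_ge0 // ltW.
have Mlam : M <= lam.
  apply: le_trans hM; rewrite -mulrA mulrCA ler_peMr ?(ltW M0) //.
  by apply: (le_trans rho1); rewrite ler_peMr ?ler1n // (le_trans ler01).
have hbox : box R gd <= (gam * #|{: t.-tuple bool}|%:R ^+ 2) ^+ 2.
  apply: le_trans (box_le_disc R gd n0) _.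
  by rewrite exprMn hgam -exprM ler_wpM2r ?exprn_ge0 // ler_wpM2l.
have nX : X != set0.
  by apply: (@ravg_deg_neq0 R); have [] := hdeg set0; rewrite cards0 expr0 divr1.
have nY : Y != set0.
  by apply: (@ravg_deg_neq0 R); have [] := hdeg set0; rewrite cards0 expr0 divr1.
have capX : spread X [set: 'I_l] M #|X|%:R.
  by apply: ravg_deg_spread => // K; have [] := hdeg K.
have capY : spread Y [set: 'I_l] M #|Y|%:R.
  by apply: ravg_deg_spread => // K; have [] := hdeg K.
have strong (W : {set {ffun 'I_l -> t.-tuple bool}}) :
    spread W [set: 'I_l] M #|W|%:R -> spread W [set: 'I_l] lam #|W|%:R.
  move=> h K b sK; apply: le_trans (h K b sK) _; rewrite ler_wpM2r //.
  by rewrite lerXn2r ?nnegrE // ltW.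
have [P [solP dP]] := leastP (protocol_exists S gd X Y).
rewrite /comm_complexity -dP.
(* Nothing is fixed yet, so [z0] is arbitrary. The caps equal the cardinalities, so the initial
   density ratio is 1. *)
have lv : live M gd (fun X Y => protocol_solves (compose S gd) X Y P) [set: 'I_l]
    [ffun=> false] X Y lam lam #|X|%:R #|Y|%:R.
  split=> //; first by move=> x y _ _ i; rewrite !inE.
  - exact: strong.
  - exact: strong.
have [T [dT hT]] := solvable_protocol n0 l0 m0 lam0 gam0 v1 (lexx _)
   hrate hv M0 rho1 hM hbox lv.
have qT : (query_complexity S <= ddepth T)%N.
  by apply: least_le; exists T; split=> // z; apply: hT => i; rewrite !inE.
have : 2 `^ (eta * t%:R / 32 * (query_complexity S)%:R) <=
    2 `^ (2%:R * (pdepth P)%:R) :> R.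
  rewrite -!pow2X pow2_nat; apply: (@le_trans _ _ (rho ^+ ddepth T)).
    apply: (@le_trans _ _ (rho ^+ query_complexity S)).
      by rewrite lerXn2r ?nnegrE ?(ltW (pow2_gt0 _)) // (le_trans ler01).
    by rewrite ler_weXn2l.
  apply: le_trans dT _; rewrite divff ?mulr1 ?mulf_neq0 ?pnatr_eq0 ?cards_eq0 //.
  by have -> : 2 ^+ 2 = 4 :> R by ring.
rewrite ler_pow2; clear; move: (t%:R : R) (query_complexity S) (pdepth P) => s q p.
by lra.
Qed.
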